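(* Let $G$ be a semi-direct product $A\rtimes\mathbb Z$ where $A$ is a countable abelian group. Let $\mathfrak H$ be the family of all virtually nilpotent subgroups of $G$. Then there exists a $3$-dimensional model for $E_{\mathfrak H}G$.
   Context: For a family $\mathfrak H$ of subgroups of $G$ (closed under conjugation and taking subgroups), a model for $E_{\mathfrak H}G$ is a $G$-CW-complex $X$ such that for every subgroup $H\le G$ the fixed point set $X^H$ is contractible if $H\in\mathfrak H$ and empty if $H\notin\mathfrak H$. All cellular actions are assumed admissible: an element stabilising a cell fixes it pointwise. *)

(* Defs.v *)
From mathcomp Require Import all_boot all_order all_algebra.
From mathcomp Require Import all_classical all_reals all_analysis.

Set Implicit Arguments.
Unset Strict Implicit.
Unset Printing Implicit Defensive.

Import Order.TTheory GRing.Theory Num.Theory.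
Import numFieldNormedType.Exports.

Local Open Scope classical_set_scope.

(** * Subgroups of a (possibly infinite) group *)

Section Groups.
Local Open Scope group_scope.
Variable G : groupType.
Implicit Types (g : G) (A H K N : set G).

Definition subgroup : set (set G) := [set H | group_closed (mem H)].

Definition lcoset g H : set G := [set g * x | x in H].

Definition conj_set H g : set G := [set x ^ g | x in H].

Definition normal_subgroup N := subgroup N /\ forall g, conj_set N g = N.

Definition abelian_set A := forall x y, A x -> A y -> commute x y.

Definition infinite_cyclic K :=
  exists f : int -> G, [/\ injective f,
    forall m n : int, f (m + n)%R = f m * f n & range f = K].

(** [G] is the internal semi-direct product of [N] and [K]. *)
Definition semidirect_product N K :=
  [/\ normal_subgroup N, subgroup K, N `&` K = [set 1] &
      [set n * k | n in N & k in K] = setT].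

Definition commutator_subgroup H K : set G :=
  smallest subgroup [set [~ h, k] | h in H & k in K].

Definition lower_central H (n : nat) : set G :=
  iter n (fun K => commutator_subgroup K H) H.

Definition nilpotent_set H := exists n, lower_central H n = [set 1].

Definition finite_index K H := finite_set [set lcoset h K | h in H].

Definition virtually_nilpotent H :=
  exists K, [/\ subgroup K, K `<=` H, nilpotent_set K & finite_index K H].

Record subgroup_family := Family {
  family_set : set (set G);
  family_subgroup : family_set `<=` subgroup;
  family_conj : forall H g, family_set H -> family_set (conj_set H g);
  family_sub : forall H K,
    family_set H -> subgroup K -> K `<=` H -> family_set K
}.

Lemma subgroupP H : subgroup H <->
  H 1 /\ forall x y, H x -> H y -> H (x / y).
Proof.
split=> -[H1 HD]; split.
- by rewrite inE in H1.
- by move=> x y Hx Hy; apply/set_mem/HD; rewrite inE.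
- exact/mem_set.
- by move=> x y /set_mem Hx /set_mem Hy; apply/mem_set/HD.
Qed.

Lemma subgroupM H x y : subgroup H -> H x -> H y -> H (x * y).
Proof.
move=> /subgroupP[H1 HD] Hx Hy; rewrite -[y]invgK; apply: (HD) => //.
by rewrite -[y^-1]mul1g; apply: HD.
Qed.

Lemma subgroupV H x : subgroup H -> H x -> H x^-1.
Proof. by move=> /subgroupP[H1 HD] Hx; rewrite -[x^-1]mul1g; apply: HD. Qed.

Lemma subgroup_conj H g : subgroup H -> subgroup (conj_set H g).
Proof.
move=> /subgroupP[H1 HD]; apply/subgroupP; split.
  by exists 1 => //; rewrite conj1g.
move=> _ _ [x Hx <-] [y Hy <-]; exists (x / y); first exact: HD.
by rewrite conjMg conjVg.
Qed.

Lemma subgroup_smallest (S : set G) : subgroup (smallest subgroup S).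
Proof.
apply/subgroupP; split=> [M [/subgroupP[]]|x y Sx Sy M [sM SM]] //.
by case/subgroupP: (sM) => _; apply; [apply: Sx|apply: Sy].
Qed.

Lemma subgroup_lower_central H n : subgroup H -> subgroup (lower_central H n).
Proof. by case: n => [|n] sH; [exact: sH|apply: subgroup_smallest]. Qed.

Lemma lower_central_sub H K n :
  K `<=` H -> lower_central K n `<=` lower_central H n.
Proof.
move=> KH; elim: n => [|n IH] //=; apply: sub_smallest2r.
  exact: subgroup_smallest.
by move=> _ [x /IH Hx [y /KH Hy <-]]; exists x => //; exists y.
Qed.

Lemma nilpotent_sub H K :
  subgroup K -> K `<=` H -> nilpotent_set H -> nilpotent_set K.
Proof.
move=> sK KH [n Hn]; exists n; rewrite eqEsubset; split.
  by rewrite -Hn; exact: lower_central_sub.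
by move=> _ ->; have /subgroupP[] := subgroup_lower_central n sK.
Qed.

Lemma lower_central_conj H g n :
  lower_central (conj_set H g) n `<=` conj_set (lower_central H n) g.
Proof.
elim: n => [|n IH] //=; apply: smallest_sub.
  exact/subgroup_conj/subgroup_smallest.
move=> _ [_ /IH[x Hx <-] [_ [y Hy <-] <-]]; exists [~ x, y].
  by apply: sub_gen_smallest; exists x => //; exists y.
by rewrite conjRg.
Qed.

Lemma nilpotent_conj H g :
  subgroup H -> nilpotent_set H -> nilpotent_set (conj_set H g).
Proof.
move=> sH [n Hn]; exists n; rewrite eqEsubset; split.
  move=> x /lower_central_conj; rewrite Hn => -[_ -> <-].
  by rewrite conj1g.
move=> _ ->.
by have /subgroupP[] := subgroup_lower_central n (subgroup_conj g sH).
Qed.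

Lemma virtually_nilpotent_conj H g :
  virtually_nilpotent H -> virtually_nilpotent (conj_set H g).
Proof.
move=> [K [sK KH nK fK]]; exists (conj_set K g); split.
- exact: subgroup_conj.
- by move=> _ [x /KH Hx <-]; exists x.
- exact: nilpotent_conj.
- apply: (sub_finite_set _ (finite_image (fun C => conj_set C g) fK)).
  move=> _ [_ [h Hh <-] <-]; exists (lcoset h K); first by exists h.
  rewrite eqEsubset; split=> [_ [_ [k Kk <-] <-]|_ [_ [k Kk <-] <-]].
    by exists (k ^ g); [exists k|rewrite conjMg].
  by exists (h * k); [exists k|rewrite conjMg].
Qed.

Lemma virtually_nilpotent_sub H K :
  virtually_nilpotent H -> subgroup K -> K `<=` H -> virtually_nilpotent K.
Proof.
move=> [L [sL LH nL fL]] sK KH; exists (L `&` K).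
have sLK : subgroup (L `&` K).
  apply/subgroupP; case/subgroupP: sL => L1 LD; case/subgroupP: sK => K1 KD.
  by split=> // x y [? ?] [? ?]; split; [apply: LD|apply: KD].
split => //; first exact: nilpotent_sub nL.
apply: (sub_finite_set _ (finite_image (fun C => C `&` K) fL)).
move=> _ [h Kh <-]; exists (lcoset h L); first by exists h => //; exact: KH.
rewrite eqEsubset; split=> [_ [[l Ll <-] Khl]|_ [l [Ll Kl] <-]].
  exists l => //; split=> //.
  by rewrite -[l](mulKg h); apply: subgroupM => //; apply: subgroupV.
by split; [exists l|apply: subgroupM].
Qed.

Definition virtually_nilpotent_family : subgroup_family.
Proof.
apply: (@Family [set H | subgroup H /\ virtually_nilpotent H]).
- by move=> H [].
- move=> H g [sH vH].
  by split; [exact: subgroup_conj|exact: virtually_nilpotent_conj].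
- by move=> H K [_ vH] sK KH; split=> //; exact: virtually_nilpotent_sub KH.
Defined.

End Groups.

(** * CW-complexes *)

Section CW.
Local Open Scope ring_scope.
Variable R : realType.

Definition sqnorm n (x : 'rV[R]_n) : R := \sum_(i < n) x ord0 i ^+ 2.
Definition disc n : set 'rV[R]_n := [set x | sqnorm x <= 1].
Definition open_disc n : set 'rV[R]_n := [set x | sqnorm x < 1].
Definition sphere n : set 'rV[R]_n := [set x | sqnorm x = 1].

Arguments disc : clear implicits.
Arguments open_disc : clear implicits.
Arguments sphere : clear implicits.

(** [char_map e] is only meaningful on [disc (cell_dim e)].  The fields
    [char_map_inj] and [char_map_open] say that it restricts to a
    homeomorphism from the open disc onto the open cell; [cw_closure_finite]
    and [cw_weak] are the conditions C and W. *)
Record cw_structure (X : topologicalType) := CWStructure {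
  cell : Type;
  cell_dim : cell -> nat;
  char_map : forall e : cell, 'rV[R]_(cell_dim e) -> X;
  open_cell := fun e : cell => char_map (e:=e) @` open_disc (cell_dim e);
  closed_cell := fun e : cell => char_map (e:=e) @` disc (cell_dim e);
  cw_hausdorff : hausdorff_space X;
  char_map_continuous : forall e,
    {within disc (cell_dim e), continuous (char_map (e:=e))};
  char_map_inj : forall e,
    {in open_disc (cell_dim e) &, injective (char_map (e:=e))};
  char_map_open : forall e (U : set 'rV[R]_(cell_dim e)), open U ->
    exists2 V : set X, open V &
      char_map (e:=e) @` (U `&` open_disc (cell_dim e)) = V `&` open_cell e;
  cw_disjoint : trivIset setT open_cell;
  cw_cover : \bigcup_e open_cell e = setT;
  cw_closure_finite : forall e, exists F : set cell,
    [/\ finite_set F, forall e', F e' -> (cell_dim e' < cell_dim e)%N &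
        char_map (e:=e) @` sphere (cell_dim e) `<=` \bigcup_(e' in F) open_cell e'];
  cw_weak : forall C : set X,
    (forall e, closed (C `&` closed_cell e)) -> closed C
}.

Definition has_dimension (X : topologicalType) (c : cw_structure X) (n : nat) :=
  (forall e : cell c, (cell_dim e <= n)%N) /\ exists e : cell c, cell_dim e = n.

Definition contractible (X : topologicalType) (S : set X) :=
  exists x0 : X, S x0 /\ exists h : X * R -> X,
    [/\ {within S `*` `[0, 1], continuous h},
        forall x t, S x -> 0 <= t <= 1 -> S (h (x, t)),
        forall x, S x -> h (x, 0) = x &
        forall x, S x -> h (x, 1) = x0].

End CW.

(** * [G]-CW-complexes and classifying spaces *)

Section GCW.
Variables (R : realType) (G : groupType).

Record action (X : topologicalType) := Action {
  act :> G -> X -> X;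
  act1 : forall x, act 1%g x = x;
  actM : forall g h x, act (g * h)%g x = act g (act h x);
  act_continuous : forall g, continuous (act g)
}.

Definition cellular (X : topologicalType) (c : cw_structure R X)
    (a : action X) :=
  forall g (e : cell c), exists2 e' : cell c,
    cell_dim e' = cell_dim e & a g @` open_cell e = open_cell e'.

Definition admissible (X : topologicalType) (c : cw_structure R X)
    (a : action X) :=
  forall g (e : cell c), a g @` open_cell e = open_cell e ->
    forall x, open_cell e x -> a g x = x.

Record gcw_complex := GCWComplex {
  gcw_space :> topologicalType;
  gcw_cw : cw_structure R gcw_space;
  gcw_act : action gcw_space;
  gcw_cellular : cellular gcw_cw gcw_act;
  gcw_admissible : admissible gcw_cw gcw_act
}.

Definition fixed_points (X : gcw_complex) (H : set G) : set X :=
  [set x | forall h, H h -> gcw_act X h x = x].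
Arguments fixed_points : clear implicits.

(** [X] is a model for the classifying space of [G] for the family [F]. *)
Definition is_model (F : subgroup_family G) (X : gcw_complex) :=
  forall H : set G, subgroup H ->
    (family_set F H -> contractible R (fixed_points X H)) /\
    (~ family_set F H -> fixed_points X H = set0).

End GCW.

(* Main.v *)
(* Write G = A x| Z, with projection eps : G -> Z and t of level 1.  Let K_0 = 1
   and let K_{i+1} consist of the b in A that t^((i+1)!) fixes modulo K_i.
   This is an increasing chain of normal subgroups, and a subgroup H not
   contained in A is virtually nilpotent iff H /\ A is contained in some K_i.

   Let F be the forest with vertices the cosets s K_i, eps s = i!, on which G acts
   by conjugation, and with an edge from s K_i to s^(i+1) K_{i+1}.  A subgroup
   fixing a vertex is virtually nilpotent.  If H is virtually nilpotent and not in A,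
   it fixes a vertex, and any two H-fixed vertices have a common ascendant:
   for h in H of level m > 0, both s^m and s'^m agree with h^(i!) modulo some
   K_j.  So the fixed set of H in F is a tree.

   Let G act on the real line L by translations through eps.  The model is the
   join L * F, of dimension 3: a subgroup of A fixes the join of L with a subforest,
   which is contractible because L is; a subgroup not in A fixes no point of
   L, and its fixed set is its fixed set in F. *)

From HB Require Import structures.
Require Import Defs.
From mathcomp Require Import all_boot all_order all_algebra.
From mathcomp Require Import all_classical all_reals all_analysis.
From mathcomp Require Import finmap lra zify.

Set Implicit Arguments.
Unset Strict Implicit.
Unset Printing Implicit Defensive.

Import Order.TTheory GRing.Theory Num.Theory.
Import numFieldNormedType.Exports.

Local Open Scope classical_set_scope.

(** * The homeomorphism from the disc to the simplex *)

Lemma continuous_big (T U : topologicalType) (I : Type) (op : U -> U -> U)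
    (u : U) (r : seq I) (f : I -> T -> U) :
  continuous (fun xy : U * U => op xy.1 xy.2) ->
  (forall i, continuous (f i)) ->
  continuous (fun y => \big[op/u]_(i <- r) f i y).
Proof. by move=> cop cf y; apply: cvg_big => // i _; exact: cf. Qed.

Section DiscToSimplex.
Local Open Scope ring_scope.
Variables (R : realType) (n : nat).
Implicit Types (x : 'rV[R]_n) (j : nat).

(** Appends a coordinate 0 at index [n]: the disc is seen in the [n.+1]-dimensional space modulo the
    diagonal, the last coordinate being normalised to 0. *)
Definition ext x j : R := oapp (x ord0) 0 (insub j).

(** The default 0 of the iterated minimum is the appended coordinate, so this is the minimum of all
    [n.+1] entries of [ext x]. *)
Definition minc x : R := \big[Num.min/0]_(i < n) x ord0 i.

Definition above x j : R := ext x j - minc x.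

Definition total x : R := \sum_(j < n.+1) above x j.

(* Spheres around 0 go to the boundaries of concentric simplices.  Capping
   [sqnorm x] at 1 keeps the values barycentric outside the disc. *)
Definition bary x j : R :=
  let q := Num.min 1 (sqnorm x) in (1 - q) / n.+1%:R + q * (above x j / total x).

Lemma ext_ord x (i : 'I_n) : ext x i = x ord0 i.
Proof. by rewrite /ext valK. Qed.

Lemma ext_n x : ext x n = 0.
Proof. by rewrite /ext insubF ?ltnn. Qed.

Lemma above_ge0 x j : 0 <= above x j.
Proof.
rewrite subr_ge0 /ext; case: insubP => [i _ _|_] /=; first exact: bigmin_le.
exact: bigmin_le_id.
Qed.

Lemma above_eq0 x : exists2 j, (j < n.+1)%N & above x j = 0.
Proof.
have : \big[Num.min/0]_(i < n) x ord0 i <= minc x by [].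
move=> /bigmin_leP[m0|[i _ mi]].
  exists n => //; apply/eqP; rewrite subr_eq0 ext_n eq_le m0.
  exact: bigmin_le_id.
exists i; first by rewrite ltnS ltnW.
by apply/eqP; rewrite subr_eq0 ext_ord eq_le mi bigmin_le.
Qed.

Lemma sqnorm_ge0 x : 0 <= sqnorm x.
Proof. by apply: sumr_ge0 => i _; exact: sqr_ge0. Qed.

Lemma sqnorm_eq0 x : sqnorm x = 0 -> x = 0.
Proof.
move=> /eqP; rewrite psumr_eq0; last by move=> i _; exact: sqr_ge0.
move=> /allP x0; apply/rowP => i; rewrite mxE; apply/eqP.
by have := x0 i (mem_index_enum _); rewrite sqrf_eq0.
Qed.

Lemma sqnorm0 : sqnorm (0 : 'rV[R]_n) = 0.
Proof. by apply: big1 => i _; rewrite mxE expr0n. Qed.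

Lemma sqnormZ (a : R) x : sqnorm (a *: x) = a ^+ 2 * sqnorm x.
Proof. by rewrite mulr_sumr; apply: eq_bigr => i _; rewrite mxE exprMn. Qed.

Lemma above0 j : above 0 j = 0.
Proof.
rewrite /above; have -> : minc 0 = 0.
  by rewrite /minc; elim/big_ind: _ => [//|a b -> ->|i _]; rewrite ?minxx ?mxE.
by rewrite subr0 /ext; case: insubP => //= i; rewrite mxE.
Qed.

Lemma aboveB x (i : 'I_n) : above x i - above x n = x ord0 i.
Proof. by rewrite /above ext_ord ext_n; lra. Qed.

Lemma total_gt0 x : x != 0 -> 0 < total x.
Proof.
move=> x0; have t0 : 0 <= total x by apply: sumr_ge0 => j _; exact: above_ge0.
rewrite lt_neqAle t0 andbT eq_sym; apply: contra x0 => /eqP /eqP.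
rewrite psumr_eq0 => [/allP a0|j _]; last exact: above_ge0.
have {}a0 (j : 'I_n.+1) : above x j = 0.
  by apply/eqP; have := a0 j (mem_index_enum _).
apply/eqP/rowP => i; rewrite mxE -aboveB.
by rewrite (a0 (widen_ord (leqnSn n) i)) (a0 ord_max) subr0.
Qed.

Let qmin x : 0 <= Num.min 1 (sqnorm x) <= 1.
Proof. by rewrite le_min ler01 sqnorm_ge0 /= ge_min lexx. Qed.

Lemma ratio_ge0 x j : 0 <= above x j / total x.
Proof.
apply: divr_ge0; first exact: above_ge0.
by apply: sumr_ge0 => i _; exact: above_ge0.
Qed.

Lemma ratio_le1 x j : (j < n.+1)%N -> above x j / total x <= 1.
Proof.
move=> jn; have [->|x0] := eqVneq x 0; first by rewrite above0 mul0r.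
rewrite ler_pdivrMr ?total_gt0// mul1r /total (bigD1 (Ordinal jn)) //= lerDl.
by apply: sumr_ge0 => i _; exact: above_ge0.
Qed.

Lemma bary_ge0 x j : 0 <= bary x j.
Proof.
have /andP[q0 q1] := qmin x; apply: addr_ge0; last exact/mulr_ge0/ratio_ge0.
by apply: divr_ge0; rewrite ?subr_ge0.
Qed.

Lemma bary_sum x : \sum_(j < n.+1) bary x j = 1.
Proof.
rewrite big_split /= sumr_const card_ord -mulr_sumr -mulr_suml -/(total x).
rewrite -[_ *+ _]mulr_natr mulfVK ?pnatr_eq0//.
have [->|/total_gt0/lt0r_neq0 t0] := eqVneq x 0; last first.
  by rewrite divff// mulr1 subrK.
by rewrite sqnorm0 [Num.min _ _]min_r ?ler01// mul0r subr0 addr0.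
Qed.

Lemma bary_gt0 x j : sqnorm x < 1 -> 0 < bary x j.
Proof.
move=> x1; apply: ltr_pwDl.
  by rewrite divr_gt0 ?ltr0n// subr_gt0 gt_min x1 orbT.
by apply: mulr_ge0; [case/andP: (qmin x)|exact: ratio_ge0].
Qed.

Lemma bary_sphere x : sqnorm x = 1 -> exists2 j, (j < n.+1)%N & bary x j = 0.
Proof.
move=> x1; have [j jn a0] := above_eq0 x; exists j => //.
by rewrite /bary x1 minxx a0 subrr !mul0r mulr0 addr0.
Qed.

(** The least barycentric coordinate is [(1 - sqnorm x) / n.+1], so the coordinates determine the
    radius. The remaining part then determines [x] up to a positive factor, and equal norms force
    this factor to be 1. *)
Lemma bary_inj x x' : sqnorm x < 1 -> sqnorm x' < 1 ->
  (forall j, (j < n.+1)%N -> bary x j = bary x' j) -> x = x'.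
Proof.
move=> x1 x1' e.
have bmin y : sqnorm y < 1 ->
    (forall j, (1 - sqnorm y) / n.+1%:R <= bary y j) /\
    exists2 j, (j < n.+1)%N & bary y j = (1 - sqnorm y) / n.+1%:R.
  move=> y1; rewrite /bary (min_r (ltW y1)); split=> [j|].
    by rewrite lerDl mulr_ge0 ?ratio_ge0 ?sqnorm_ge0.
  by have [j jn a0] := above_eq0 y; exists j; rewrite // a0 mul0r mulr0 addr0.
have [lx [j jn bj]] := bmin _ x1; have [lx' [j' jn' bj']] := bmin _ x1'.
have q : sqnorm x = sqnorm x'.
  have : (1 - sqnorm x) / n.+1%:R = (1 - sqnorm x') / n.+1%:R.
    apply/eqP; rewrite eq_le -{1}bj' -{2}bj -e// (e j)//.
    by rewrite lx lx'.
  by move=> /(mulIf _); rewrite invr_eq0 pnatr_eq0 => /(_ isT); lra.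
have [x0|x0] := eqVneq x 0.
  by move: q; rewrite x0 sqnorm0 => /esym/sqnorm_eq0.
have x0' : x' != 0.
  by apply: contra x0 => /eqP h; move: q; rewrite h sqnorm0 => /sqnorm_eq0 ->.
have sx0 : sqnorm x != 0 by apply: contra x0 => /eqP/sqnorm_eq0 ->.
have tx := total_gt0 x0; have tx' := total_gt0 x0'.
have r k : (k < n.+1)%N -> above x k / total x = above x' k / total x'.
  move=> /e; rewrite /bary -q !(min_r (ltW x1)) => /addrI.
  by move=> /(mulfI sx0).
have ex i : x ord0 i / total x = x' ord0 i / total x'.
  by rewrite -!aboveB [LHS]mulrBl [RHS]mulrBl (r n)// (r i)// ltnS ltnW.
have xl : x = (total x / total x') *: x'.
  apply/rowP => i; rewrite mxE mulrAC -mulrA -ex mulrC -mulrA mulVf ?mulr1//.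
  exact: lt0r_neq0.
have : (total x / total x') ^+ 2 = 1.
  apply: (mulIf sx0); rewrite [in LHS]q -sqnormZ -xl mul1r //.
move=> /eqP; rewrite sqrf_eq1 => /orP[/eqP l1|/eqP l1].
  by rewrite xl l1 scale1r.
have : 0 < total x / total x' by exact: divr_gt0.
by rewrite l1 oppr_gt0 ltr10.
Qed.

(** The inverse is explicit: the direction is that of [z], with entries [c i - c n], and the squared
    norm is [q = 1 - n.+1 * min c]. The barycentre, where [z = 0], is treated apart. *)
Lemma bary_surj (c : nat -> R) : (forall j, (j < n.+1)%N -> 0 <= c j) ->
  \sum_(j < n.+1) c j = 1 ->
  exists x, [/\ sqnorm x <= 1, forall j, (j < n.+1)%N -> bary x j = c j &
    (forall j, (j < n.+1)%N -> 0 < c j) -> sqnorm x < 1].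
Proof.
move=> c0 c1.
pose k := [arg min_(i < (ord0 : 'I_n.+1)) c i]%O.
have ck (j : nat) : (j < n.+1)%N -> c k <= c j.
  by rewrite /k; case: arg_minP => //= i _ h jn; exact: (h (Ordinal jn)).
pose z : 'rV[R]_n := \row_i (c i - c n).
have zE j : (j < n.+1)%N -> ext z j = c j - c n.
  rewrite ltnS leq_eqVlt => /orP[/eqP ->|jn]; first by rewrite ext_n subrr.
  by rewrite (ext_ord z (Ordinal jn)) mxE.
have aZ a j : 0 <= a -> (j < n.+1)%N -> above (a *: z) j = a * (c j - c k).
  move=> a0 jn.
  have eZ i : (i < n.+1)%N -> ext (a *: z) i = a * (c i - c n).
    rewrite ltnS leq_eqVlt => /orP[/eqP ->|i_n].
      by rewrite ext_n subrr mulr0.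
    by rewrite (ext_ord _ (Ordinal i_n)) !mxE.
  have [i i_n /eqP] := above_eq0 (a *: z); rewrite subr_eq0 => /eqP mE.
  have : ext (a *: z) i = a * (c k - c n).
    apply/eqP; rewrite eq_le; apply/andP; split.
      rewrite mE -eZ ?ltn_ord// -subr_ge0; exact: above_ge0.
    by rewrite eZ// ler_wpM2l// lerB// ck.
  by rewrite mE /above eZ// => ->; lra.
pose q := 1 - n.+1%:R * c k.
have qE : \sum_(j < n.+1) (c j - c k) = q.
  by rewrite /q mulr_natl sumrB c1 sumr_const card_ord.
have q0 : 0 <= q by rewrite -qE; apply: sumr_ge0 => j _; rewrite subr_ge0 ck.
have q1 : q <= 1 by rewrite gerBl mulr_ge0// c0.
have [z0|z0] := eqVneq z 0.
  have e (j : nat) : (j < n.+1)%N -> c j = n.+1%:R^-1.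
    have en i : (i < n.+1)%N -> c i = c n.
      move=> /zE; rewrite z0 /ext => /esym/eqP; case: insubP => [l _ _|_] /=.
        by rewrite mxE subr_eq0 => /eqP.
      by rewrite subr_eq0 => /eqP.
    move: c1; rewrite (eq_bigr (fun=> c n)); last first.
      by move=> i _; exact: en.
    rewrite sumr_const card_ord => h jn; rewrite en//.
    have n0 : n.+1%:R != 0 :> R by rewrite pnatr_eq0.
    by apply: (mulfI n0); rewrite mulr_natl h divff.
  exists 0; rewrite sqnorm0 ler01 ltr01; split=> // j jn.
  by rewrite /bary sqnorm0 [Num.min _ _]min_r ?ler01// e// mul0r addr0 subr0 mul1r.
have sz : 0 < sqnorm z.
  rewrite lt_neqAle sqnorm_ge0 eq_sym andbT.
  by apply: contra z0 => /eqP/sqnorm_eq0 ->.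
pose a := Num.sqrt (q / sqnorm z).
have a0 : 0 <= a by exact: sqrtr_ge0.
have sa : sqnorm (a *: z) = q.
  rewrite sqnormZ sqr_sqrtr ?divr_ge0 ?sqnorm_ge0//.
  by rewrite mulfVK// lt0r_neq0.
have q_gt0 : 0 < q.
  rewrite lt_neqAle q0 andbT eq_sym; apply: contra z0.
  rewrite -qE psumr_eq0 => [/allP h|j _]; last by rewrite subr_ge0 ck.
  have {}h (i : 'I_n.+1) : c i = c k.
    by have := h i (mem_index_enum _); rewrite subr_eq0 => /eqP.
  apply/eqP/rowP => i; rewrite !mxE.
  by rewrite (h (widen_ord (leqnSn n) i)) (h ord_max) subrr.
have a_gt0 : 0 < a by rewrite sqrtr_gt0 divr_gt0.
have ta : total (a *: z) = a * q.
  by rewrite /total -qE mulr_sumr; apply: eq_bigr => j _; rewrite aZ.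
exists (a *: z); rewrite sa; split=> // [j jn|cp].
  rewrite /bary sa (min_r q1) ta aZ//.
  have -> : a * (c j - c k) / (a * q) = (c j - c k) / q.
    by rewrite -mulf_div divff ?mul1r// lt0r_neq0.
  have -> : 1 - q = n.+1%:R * c k by rewrite /q; lra.
  rewrite [q * _]mulrC mulfVK ?lt0r_neq0// mulrAC divff ?pnatr_eq0// mul1r.
  by rewrite addrC subrK.
by rewrite /q gtrBl mulr_gt0 ?ltr0n// cp.
Qed.

Lemma continuous_sqnorm : continuous (@sqnorm R n).
Proof.
apply: continuous_big => [|i x]; first exact: add_continuous.
have c := @coord_continuous R 1 n ord0 i x.
exact: (continuousM c c).
Qed.

Lemma continuous_above j : continuous (above ^~ j).
Proof.
move=> x; apply: (@continuousB _ R^o _ (ext ^~ j) minc).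
  rewrite /ext; case: (insub j) => [i|] /=; last first.
    exact: cst_continuous.
  exact: coord_continuous.
apply: continuous_big => [|i]; last exact: coord_continuous.
exact: (@min_continuous _ R).
Qed.

Lemma continuous_total : continuous total.
Proof.
apply: continuous_big => [|i]; first exact: add_continuous.
exact: continuous_above.
Qed.

Lemma continuous_bary j : (j < n.+1)%N -> continuous (bary ^~ j).
Proof.
move=> jn x.
have cq : {for x, continuous (fun y : 'rV[R]_n => Num.min 1 (sqnorm y))}.
  apply: (@continuous_min _ _ (fun=> 1)); first exact: cst_continuous.
  exact: continuous_sqnorm.
apply: (@continuousD _ R^o _ (fun y => (1 - Num.min 1 (sqnorm y)) / n.+1%:R)).
  apply: (@continuousM _ _ (fun y => 1 - Num.min 1 (sqnorm y))).
    by apply: (@continuousB _ R^o _ (fun=> 1)) => //; exact: cst_continuous.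
  exact: cst_continuous.
(* The quotient by [total] need not have a limit at 0; there the product with the capped norm is
   squeezed between 0 and [sqnorm]. *)
have [->|x0] := eqVneq x 0; last first.
  apply: continuousM => //; apply: continuousM; first exact: continuous_above.
  by apply: continuousV; [exact/lt0r_neq0/total_gt0|exact: continuous_total].
pose f (y : 'rV[R]_n) := Num.min 1 (sqnorm y) * (above y j / total y).
suff : f y @[y --> (0 : 'rV[R]_n)] --> (0 : R).
  have <- : f 0 = 0 by rewrite /f above0 mul0r mulr0.
  by [].
apply: (@squeeze_cvgr _ _ (nbhs_filter (0 : 'rV[R]_n)) R (fun=> 0) (@sqnorm R n)).
- apply: (@nearW _ _ _ (nbhs_filter (0 : 'rV[R]_n))) => y.
  have /andP[p0 p1] := qmin y.
  rewrite mulr_ge0 ?ratio_ge0//= -[leRHS]mulr1 ler_pM ?ratio_ge0 ?ratio_le1//.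
  by rewrite ge_min lexx orbT.
- exact: (@cst_continuous _ _ (0 : R)).
- by have := @continuous_sqnorm 0; rewrite /continuous_at sqnorm0.
Qed.

Lemma compact_disc : compact (@disc R n).
Proof.
apply: (@subclosed_compact _ _ [set v : 'rV[R]_n | forall i, `[-1, 1]%classic (v ord0 i)]).
- apply: (@closed_comp _ _ (@sqnorm R n) [set y | y <= 1]).
    by move=> x _; exact: continuous_sqnorm.
  exact: closed_le.
- by apply: (@rV_compact R n (fun=> `[-1, 1]%classic)) => i; exact: segment_compact.
- move=> x /= x1 i; rewrite in_itv /= -ler_norml -(@expr_le1 _ 2)//.
  rewrite real_normK ?num_real//; apply: le_trans x1.
  rewrite /sqnorm (bigD1 i)//= lerDl.
  by apply: sumr_ge0 => k _; exact: sqr_ge0.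
Qed.

End DiscToSimplex.
(** * Realization of a flag complex *)

Section Realization.
Local Open Scope ring_scope.
Variables (R : realType) (W : choiceType) (adj : W -> W -> Prop).
Implicit Types (s r : {fset W}) (v w : W).

(* [adj] need not be reflexive: the vertices of the complex are the [w] with
   [adj w w]. *)
Definition simplex s := s != fset0 /\ {in s &, forall v w, adj v w}.

Definition barycentric (f : W -> R) := exists s, [/\ simplex s,
  forall w, w \notin s -> f w = 0, forall w, 0 <= f w & \sum_(w <- s) f w = 1].

Record flag_point := Point { weight :> W -> R; pointP : barycentric weight }.

HB.instance Definition _ := gen_eqMixin flag_point.
HB.instance Definition _ := gen_choiceMixin flag_point.

Implicit Types x y : flag_point.

Lemma point_ext x y : (forall w, x w = y w) -> x = y.
Proof.
case: x y => [f Pf] [g Pg] /= /funext fg.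
by rewrite fg in Pf *; congr Point; exact: Prop_irrelevance.
Qed.

Lemma coord_ge0 x w : 0 <= x w.
Proof. by case: x => f [s []]. Qed.

(** The simplex witnessing [barycentric] is not unique; discarding zero coordinates makes the result
    independent of the choice. *)
Definition supp x : {fset W} := [fset w in sval (cid (pointP x)) | x w != 0]%fset.

Lemma mem_supp x w : (w \in supp x) = (x w != 0).
Proof.
rewrite /supp; case: cid => s [_ x0 _ _] /=; rewrite !inE /=.
by case: (boolP (w \in s)) => //= /x0 ->; rewrite eqxx.
Qed.

Lemma supp_sub x s : (supp x `<=` s)%fset <-> (forall w, w \notin s -> x w = 0).
Proof.
split=> [/fsubsetP xs w ws|x0].
  by apply/eqP; apply: contraNT ws; rewrite -mem_supp => /xs.
apply/fsubsetP => w; rewrite mem_supp; apply: contraNT => /x0 ->; exact: eqxx.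
Qed.

Lemma sum_coord x s : (supp x `<=` s)%fset -> \sum_(w <- s) x w = 1.
Proof.
move=> xs; case: (pointP x) => s' [_ x0 _ <-].
rewrite -(big_fset_incl _ xs) => [|w _]; last first.
  by rewrite mem_supp negbK => /eqP.
apply: big_fset_incl => [|w _]; first exact/supp_sub.
by rewrite mem_supp negbK => /eqP.
Qed.

Lemma simplex_sub s r : simplex s -> (r `<=` s)%fset -> r != fset0 -> simplex r.
Proof.
by move=> [_ ss] /fsubsetP rs r0; split=> // v w /rs vs /rs ws; exact: ss.
Qed.

Lemma supp_neq0 x : supp x != fset0.
Proof.
apply/negP => /eqP x0; have := sum_coord (fsubset_refl (supp x)).
by rewrite x0 big_nil => /eqP; rewrite eq_sym oner_eq0.
Qed.

Lemma simplex_supp x : simplex (supp x).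
Proof.
have [s [ss /supp_sub xs _ _]] := pointP x.
exact: simplex_sub ss xs (supp_neq0 x).
Qed.

(** Neighbourhoods of [x] inside the closed simplex [s], for the sup distance of coordinates;
    relevant when [supp x] lies in [s]. *)
Definition simplex_nbhs s x : set_system flag_point :=
  [set U | exists2 e : R, 0 < e & forall y, (supp y `<=` s)%fset ->
    {in s, forall w, `|y w - x w| < e} -> U y].

Global Instance simplex_nbhs_filter s x : Filter (simplex_nbhs s x).
Proof.
split=> [|P Q [e e0 Pe] [d d0 Qd]|P Q PQ [e e0 Pe]].
- by exists 1.
- exists (Num.min e d) => [|y ys yx]; first by rewrite lt_min e0.
  by split; [apply: Pe|apply: Qd] => // w /yx; rewrite lt_min => /andP[].
- by exists e => // y ys yx; exact/PQ/Pe.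
Qed.

(** The weak topology: openness is tested on each closed simplex separately. On complexes that are
    not locally finite it is finer than the topology of the coordinates. *)
Definition point_open : set_system flag_point :=
  [set U | forall x s, U x -> simplex s -> (supp x `<=` s)%fset ->
    simplex_nbhs s x U].

Lemma point_openT : point_open setT.
Proof. by move=> x s _ _ _; exact: filterT. Qed.

Lemma point_openI : setI_closed point_open.
Proof.
by move=> U V oU oV x s [Ux Vx] ss xs; apply: filterI; [exact: oU|exact: oV].
Qed.

Lemma point_open_bigU (I : Type) (f : I -> set flag_point) :
  (forall i, point_open (f i)) -> point_open (\bigcup_i f i).
Proof.
move=> of_ x s [i _ fx] ss xs; apply: filterS (of_ i x s fx ss xs).
by move=> y fy; exists i.
Qed.

HB.instance Definition _ := isOpenTopological.Build flag_point
  point_openT point_openI point_open_bigU.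

Lemma point_openE (U : set flag_point) : open U = point_open U.
Proof. by []. Qed.

Lemma simplex_nbhs_coord s x w :
  (supp x `<=` s)%fset -> weight ^~ w @ simplex_nbhs s x --> x w.
Proof.
move=> xs; apply/cvgrPdist_lt => e e0; exists e => // y ys yx.
have [/yx|ws] := boolP (w \in s); first by rewrite distrC.
by rewrite (supp_sub y s).1// (supp_sub x s).1// subrr normr0.
Qed.

Lemma coord_continuous_point w : continuous (weight ^~ w).
Proof.
move=> x; apply/(cvgrPdist_lt (FF := nbhs_filter x)) => e e0.
exists [set y | `|x w - y w| < e]; split=> //=; last by rewrite subrr normr0.
move=> y s /= xy ss ys; have d0 : 0 < e - `|x w - y w| by rewrite subr_gt0.
have /cvgrPdist_lt/(_ _ d0) := @simplex_nbhs_coord s y w ys.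
apply: filterS => z; rewrite ltrBrDl; apply: le_lt_trans.
by rewrite -[x w - z w](subrKA (y w)) ler_normD.
Qed.

Lemma point_hausdorff : hausdorff_space flag_point.
Proof.
move=> x y xy; apply: point_ext => w.
apply: (@norm_hausdorff R R) => A B /coord_continuous_point nA.
move=> /coord_continuous_point nB.
by have [z [Az Bz]] := xy _ _ nA nB; exists (z w).
Qed.

(* The simplices in [ss] not containing [supp x] are avoided automatically, as
   some coordinate stays positive. *)
Lemma cvg_point (T : Type) (F : set_system T) (FF : Filter F) (f : T -> flag_point) x
    (ss : seq {fset W}) :
  {in ss, forall s, simplex s} ->
  (\forall t \near F, exists2 s, s \in ss & (supp (f t) `<=` s)%fset) ->
  (forall w, f t w @[t --> F] --> x w) ->
  f @ F --> x.
Proof.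
move=> sss Fss fx U [V [oV Vx VU]]; apply: filterS VU _.
have key s : s \in ss -> \forall t \near F, (supp (f t) `<=` s)%fset -> V (f t).
  move=> /sss ss'; have [xs|/fsubsetPn[w]] := boolP (supp x `<=` s)%fset.
    have [e e0 Ve] := oV x s Vx ss' xs.
    have : \forall t \near F, (\bigcap_(w in [set` s]) [set t | `|x w - f t w| < e]) t.
      by apply: filter_bigI => w ws; move/cvgrPdist_lt: (fx w); apply.
    apply: filterS => t xt ts; apply: Ve => // w ws.
    by rewrite distrC; exact: xt.
  rewrite mem_supp => x0 ws.
  have x_gt0 : 0 < x w by rewrite lt_neqAle eq_sym x0 coord_ge0.
  have /cvgrPdist_lt/(_ _ x_gt0) := fx w.
  apply: filterS => t xt /supp_sub/(_ w ws) ft0.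
  by move: xt; rewrite ft0 subr0 ger0_norm ?coord_ge0// ltxx.
have {}key : \forall t \near F, forall s, s \in ss ->
    (supp (f t) `<=` s)%fset -> V (f t).
  elim: ss {sss Fss} key => [|s ss IH] key; first exact: nearW.
  have /IH : forall s', s' \in ss ->
      \forall t \near F, (supp (f t) `<=` s')%fset -> V (f t).
    by move=> s' ss'; apply: key; rewrite inE ss' orbT.
  have /key : s \in s :: ss by rewrite inE eqxx.
  apply: filterS2 => t ts tss s'; rewrite inE => /orP[/eqP ->//|].
  exact: tss.
by apply: filterS2 key Fss => t ts [s /ts h /h].
Qed.

Lemma card_simplex s : simplex s -> #|`s| = #|`s|.-1.+1.
Proof. by case=> s0 _; rewrite prednK// cardfs_gt0. Qed.

(** * Characteristic maps of the simplices *)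

Section CharMap.
Variables (s : {fset W}) (ss : simplex s).
Local Notation n := (#|`s|.-1).

Definition char_coord (u : 'rV[R]_n) w : R :=
  if w \in s then bary u (index w s) else 0.

Lemma sum_fset (f : nat -> R) :
  \sum_(w <- s) f (index w s) = \sum_(j < n.+1) f j.
Proof.
have [w0 w0s] := fset0Pn _ ss.1.
rewrite (big_nth w0) big_mkord -card_simplex//.
by apply: eq_bigr => j _; rewrite index_uniq// fset_uniq.
Qed.

Lemma char_coord_barycentric u : barycentric (char_coord u).
Proof.
exists s; split=> // [w /negPf ws|w|]; rewrite /char_coord.
- by rewrite ws.
- by case: ifP => // _; exact: bary_ge0.
- rewrite big_seq (eq_bigr (fun w => bary u (index w s))) => [|w ->//].
  by rewrite -big_seq sum_fset bary_sum.
Qed.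

Definition char_point u : flag_point := Point (char_coord_barycentric u).

Lemma index_card w : w \in s -> (index w s < n.+1)%N.
Proof. by move=> ws; rewrite -card_simplex// index_mem. Qed.

Lemma char_point_nth j : (j < n.+1)%N ->
  exists2 w, w \in s & index w s = j.
Proof.
have [w0 w0s] := fset0Pn _ ss.1.
rewrite -card_simplex// => jn; exists (nth w0 s j); first exact: mem_nth.
by rewrite index_uniq// fset_uniq.
Qed.

Lemma supp_char_sub u : (supp (char_point u) `<=` s)%fset.
Proof. by apply/supp_sub => w /negPf ws /=; rewrite /char_coord ws. Qed.

Lemma char_point_continuous : continuous char_point.
Proof.
move=> u; apply: (@cvg_point _ _ (nbhs_filter u) _ _ [:: s]).
- by move=> r; rewrite inE => /eqP ->.
- by apply: (@nearW _ _ _ (nbhs_filter u)) => v; exists s;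
    [rewrite inE|exact: supp_char_sub].
- move=> w /=; rewrite /char_coord; case: ifPn => [/index_card ws|_].
    exact: continuous_bary.
  exact: (@cst_continuous _ _ (0 : R)).
Qed.

Lemma char_point_inj : {in @open_disc R n &, injective char_point}.
Proof.
move=> u v /set_mem u1 /set_mem v1 uv; apply: bary_inj => // j.
move=> /char_point_nth[w ws <-].
by have := congr1 (weight ^~ w) uv; rewrite /= /char_coord ws.
Qed.

Lemma char_point_open : char_point @` @open_disc R n = [set x | supp x = s].
Proof.
rewrite eqEsubset; split=> [_ [u u1 <-]|x /= xs].
  apply/eqP; rewrite eqEfsubset supp_char_sub; apply/fsubsetP => w ws.
  by rewrite mem_supp /= /char_coord ws lt0r_neq0// bary_gt0.
have [w0 w0s] := fset0Pn _ ss.1.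
have wE w : w \in s -> x (nth w0 s (index w s)) = x w by move=> ws; rewrite nth_index.
have [j jn||u [_ ux u1]] := @bary_surj R n (fun j => x (nth w0 s j)).
- exact: coord_ge0.
- rewrite -(sum_fset (fun j => x (nth w0 s j))) big_seq.
  by rewrite (eq_bigr _ wE) -big_seq sum_coord// xs.
exists u.
  apply: u1 => j jn; rewrite lt_neqAle coord_ge0 andbT eq_sym -mem_supp xs.
  by rewrite mem_nth// card_simplex.
apply: point_ext => w /=; rewrite /char_coord; case: ifPn => [ws|].
  by rewrite ux ?index_card// wE.
by rewrite -xs mem_supp negbK => /eqP.
Qed.

Lemma char_point_disc :
  char_point @` @disc R n = [set x | (supp x `<=` s)%fset].
Proof.
rewrite eqEsubset; split=> [_ [u _ <-]|x /= xs]; first exact: supp_char_sub.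
have [w0 w0s] := fset0Pn _ ss.1.
have wE w : w \in s -> x (nth w0 s (index w s)) = x w by move=> ws; rewrite nth_index.
have [j jn||u [u1 ux _]] := @bary_surj R n (fun j => x (nth w0 s j)).
- exact: coord_ge0.
- rewrite -(sum_fset (fun j => x (nth w0 s j))) big_seq.
  by rewrite (eq_bigr _ wE) -big_seq sum_coord.
exists u => //; apply: point_ext => w /=; rewrite /char_coord.
case: ifPn => [ws|/((supp_sub x s).1 xs) //].
by rewrite ux ?index_card// wE.
Qed.

Lemma char_point_sphere u : @sphere R n u -> (supp (char_point u) `<` s)%fset.
Proof.
move=> /bary_sphere[j /char_point_nth[w ws <-] b0].
rewrite fproperEneq supp_char_sub andbT; apply/negP => /eqP us.
by move: ws; rewrite -us mem_supp /= /char_coord; case: ifP; rewrite ?b0 eqxx.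
Qed.

End CharMap.

(** * The CW-structure of the realization *)

Definition flag_cell := {s : {fset W} | simplex s}.
Definition flag_dim (e : flag_cell) := #|`sval e|.-1.
Definition flag_char (e : flag_cell) : 'rV[R]_(flag_dim e) -> flag_point :=
  char_point (svalP e).

(** [V] is the complement of the image of the closed disc minus [U], which is compact and so closed.
    A point of the sphere has smaller support than a point of the open disc, so their images
    differ. *)
Lemma flag_char_homeo e (U : set 'rV[R]_(flag_dim e)) : open U ->
  exists2 V : set flag_point, open V &
    flag_char (e:=e) @` (U `&` @open_disc R (flag_dim e)) =
    V `&` flag_char (e:=e) @` @open_disc R (flag_dim e).
Proof.
move=> oU; exists (~` (flag_char (e:=e) @` (@disc R (flag_dim e) `\` U))).
  apply: closed_openC; apply: compact_closed; first exact: point_hausdorff.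
  apply: continuous_compact.
    exact/continuous_subspaceT/char_point_continuous.
  by apply: compact_closedI; [exact: compact_disc|exact: open_closedC].
rewrite eqEsubset; split=> [_ [u [Uu u1] <-]|t [nV [u u1 ut]]]; last first.
  subst t; exists u => //; split=> //; apply: contrapT => Uu; apply: nV.
  by exists u => //; split=> //; exact: ltW.
split; last by exists u.
move=> [v [v1 Uv] vu]; apply: Uv; suff -> : v = u by [].
apply: (@char_point_inj _ (svalP e)) (vu); last exact: mem_set.
apply: mem_set; have : supp (flag_char u) = sval e.
  have : (flag_char (e:=e) @` @open_disc R (flag_dim e)) (flag_char u) by exists u.
  by rewrite /flag_char char_point_open.
rewrite -vu => ve; move: v1.
rewrite /disc /open_disc /= le_eqVlt => /orP[/eqP/(char_point_sphere (svalP e))|//].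
by rewrite -/(flag_char v) ve fproperEneq eqxx.
Qed.

Lemma flag_cell_eq (e e' : flag_cell) : sval e = sval e' -> e = e'.
Proof.
case: e e' => s ss [s' ss'] /= E; rewrite -E in ss' *.
by rewrite (Prop_irrelevance ss ss').
Qed.

Lemma flag_disjoint :
  trivIset setT (fun e => flag_char (e:=e) @` @open_disc R (flag_dim e)).
Proof.
move=> e e' _ _ [x []]; rewrite /flag_char !char_point_open => /= xe xe'.
by apply: flag_cell_eq; rewrite -xe.
Qed.

Definition supp_cell x : flag_cell := exist _ (supp x) (simplex_supp x).

Lemma flag_cell_supp x :
  (flag_char (e:=supp_cell x) @` @open_disc R (flag_dim (supp_cell x))) x.
Proof. by rewrite /flag_char char_point_open. Qed.

Lemma flag_cover :
  \bigcup_e (flag_char (e:=e) @` @open_disc R (flag_dim e)) = setT.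
Proof.
by rewrite -subTset => x _; exists (supp_cell x); [|exact: flag_cell_supp].
Qed.

(** A boundary point lies in the open cell of its own support, which is one of the finitely many
    proper faces. *)
Lemma flag_closure_finite e : exists F : set flag_cell,
  [/\ finite_set F, forall e', F e' -> (flag_dim e' < flag_dim e)%N &
    flag_char (e:=e) @` @sphere R (flag_dim e) `<=`
    \bigcup_(e' in F) (flag_char (e:=e') @` @open_disc R (flag_dim e'))].
Proof.
exists [set e' | (sval e' `<` sval e)%fset]; split.
- apply: (@sub_finite_set _ _ (sval @^-1` [set` fpowerset (sval e)])).
    by move=> e' /= /fproper_sub; rewrite fpowersetE.
  apply: finite_preimage; last exact: finite_fset.
  by move=> e1 e2 _ _; exact: flag_cell_eq.
- move=> e' /= /fproper_ltn_card.
  by rewrite (card_simplex (svalP e)) (card_simplex (svalP e')).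
- move=> _ [u u1 <-]; exists (supp_cell (flag_char u)); last exact: flag_cell_supp.
  exact: char_point_sphere.
Qed.

Lemma flag_weak (C : set flag_point) :
  (forall e, closed (C `&` flag_char (e:=e) @` @disc R (flag_dim e))) -> closed C.
Proof.
move=> clC.
suff oC : open (~` C) by rewrite -[C]setCK; exact: (@open_closedC flag_point).
rewrite point_openE => x s Cx ss xs.
have := closed_openC (clC (exist _ s ss)).
rewrite /flag_char char_point_disc => oC.
have [|d d0 dC] := oC x s _ ss xs; first by case.
by exists d => // y ys yx Cy; exact: (dC y ys yx).
Qed.

Definition flag_cw : cw_structure R flag_point :=
  CWStructure point_hausdorff
    (fun e => continuous_subspaceT (@char_point_continuous _ (svalP e)))
    (fun e => @char_point_inj _ (svalP e))
    flag_char_homeo flag_disjoint flag_cover flag_closure_finite flag_weak.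

Lemma flag_open_cell (e : flag_cell) :
  @open_cell R flag_point flag_cw e = [set x | supp x = sval e].
Proof. exact: char_point_open. Qed.

End Realization.
(** * Group actions on a flag complex *)

Section FlagAction.
Local Open Scope ring_scope.
Variables (R : realType) (G : groupType) (W : choiceType) (adj : W -> W -> Prop).
Variable aW : G -> W -> W.
Hypothesis aW1 : forall w, aW 1%g w = w.
Hypothesis aWM : forall g h w, aW (g * h)%g w = aW g (aW h w).
Hypothesis adj_aW : forall g v w, adj v w -> adj (aW g v) (aW g w).
Hypothesis aW_adm : forall g w,
  adj w (aW g w) -> adj w (aW g (aW g w)) -> aW g w = w.
Local Notation flag_point := (flag_point R adj).
Implicit Types (x y : flag_point) (g : G) (s : {fset W}) (w : W).

Lemma aWK g : cancel (aW g) (aW g^-1%g).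
Proof. by move=> w; rewrite -aWM mulVg aW1. Qed.

Lemma aWKV g : cancel (aW g^-1%g) (aW g).
Proof. by move=> w; rewrite -aWM mulgV aW1. Qed.

Definition translate g s := [fset aW g w | w in s]%fset.

Lemma mem_translate g s w : (w \in translate g s) = (aW g^-1%g w \in s).
Proof.
apply/imfsetP/idP => [[v vs ->]|ws]; first by rewrite aWK.
by exists (aW g^-1%g w); rewrite ?aWKV.
Qed.

Lemma simplex_translate g s : simplex adj s -> simplex adj (translate g s).
Proof.
move=> [/fset0Pn[w ws] ss]; split.
  by apply/fset0Pn; exists (aW g w); rewrite mem_translate aWK.
by move=> u v; rewrite !mem_translate => us vs; rewrite -(aWKV g u) -(aWKV g v);
  apply: adj_aW; exact: ss.
Qed.

Lemma card_translate g s : #|` translate g s| = #|` s|.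
Proof. exact: card_imfset (can_inj (aWK g)). Qed.

Lemma act_barycentric g x : barycentric adj (fun w => x (aW g^-1%g w)).
Proof.
exists (translate g (supp x)); split.
- exact/simplex_translate/simplex_supp.
- move=> w; rewrite mem_translate => /((supp_sub x (supp x)).1 _); apply.
  exact: fsubset_refl.
- by move=> w; exact: coord_ge0.
- rewrite big_imfset /= => [|u v _ _]; last exact: can_inj (aWK g) u v.
  under eq_bigr do rewrite aWK.
  exact: sum_coord.
Qed.

Definition flag_translation g x : flag_point := Point (act_barycentric g x).

Lemma supp_translation g x : supp (flag_translation g x) = translate g (supp x).
Proof. by apply/fsetP => w; rewrite mem_translate !mem_supp. Qed.

Lemma flag_translation1 x : flag_translation 1%g x = x.
Proof. by apply: point_ext => w /=; rewrite invg1 aW1. Qed.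

Lemma flag_translationM g h x :
  flag_translation (g * h)%g x = flag_translation g (flag_translation h x).
Proof. by apply: point_ext => w /=; rewrite invgM aWM. Qed.

(** Translation permutes simplices and coordinates, so openness of the preimage on [s] is openness
    of [U] on [translate g s]. *)
Lemma flag_translation_continuous g : continuous (flag_translation g).
Proof.
apply/continuousP => U oU; rewrite point_openE => x s Ux ss xs.
have [||e e0 Ue] := oU (flag_translation g x) (translate g s) Ux.
- exact: simplex_translate.
- by rewrite supp_translation; apply/fsubsetP => w; rewrite !mem_translate;
    exact: (fsubsetP xs).
exists e => // y ys yx; apply: Ue.
  by rewrite supp_translation; apply/fsubsetP => w; rewrite !mem_translate;
    exact: (fsubsetP ys).
by move=> w; rewrite mem_translate => ws /=; exact: yx.
Qed.

Definition flag_action : action G flag_point :=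
  Action flag_translation1 flag_translationM flag_translation_continuous.

Lemma flag_translation_cell g s : simplex adj s ->
  flag_translation g @` [set x | supp x = s] =
  [set x : flag_point | supp x = translate g s].
Proof.
move=> ss; rewrite eqEsubset; split=> [_ [x /= <- <-]|x /= xs].
  exact: supp_translation.
exists (flag_translation g^-1%g x); last first.
  by rewrite -flag_translationM mulgV flag_translation1.
rewrite /= supp_translation xs; apply/fsetP => w.
by rewrite !mem_translate invgK aWK.
Qed.

Lemma flag_cellular : cellular (flag_cw R adj) flag_action.
Proof.
move=> g e; exists (exist _ _ (simplex_translate g (svalP e))).
  by rewrite /= /flag_dim /= card_translate.
by rewrite !flag_open_cell flag_translation_cell//; exact: svalP.
Qed.

(** Stability puts [aW g w] and [aW g (aW g w)] in the same simplex as [w], which are the two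
    adjacencies required by [aW_adm]. *)
Lemma translate_fix g s w :
  simplex adj s -> translate g s = s -> w \in s -> aW g w = w.
Proof.
move=> [_ ss] gs ws.
have st v : v \in s -> aW g v \in s by move=> vs; rewrite -gs mem_translate aWK.
by have s1 := st _ ws; apply: aW_adm; apply: ss => //; exact: st.
Qed.

Lemma aW_fixV g w : aW g w = w -> aW g^-1%g w = w.
Proof. by move=> gw; rewrite -{1}gw aWK. Qed.

Lemma translation_fix g x :
  flag_translation g x = x <-> forall w, x w != 0 -> aW g w = w.
Proof.
split=> [gx w xw|gx].
  by apply: (translate_fix (simplex_supp x)); rewrite ?mem_supp// -supp_translation gx.
apply: point_ext => w /=; have [xw|] := boolP (x w != 0).
  by rewrite aW_fixV// gx.
rewrite negbK => /eqP xw; have [xgw|/gx] := eqVneq (x (aW g^-1%g w)) 0.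
  by rewrite xgw xw.
by rewrite aWKV => <-.
Qed.

Lemma flag_admissible : admissible (flag_cw R adj) flag_action.
Proof.
move=> g e; rewrite flag_open_cell flag_translation_cell => [ge x /= xe|]; last exact: svalP.
apply/translation_fix => w; rewrite -mem_supp; apply: translate_fix (simplex_supp x) _.
by have : [set x : flag_point | supp x = sval e] x by []; rewrite -ge /= xe.
Qed.

Definition flag_gcw : gcw_complex R G := GCWComplex flag_cellular flag_admissible.

(** By admissibility at the vertices, the fixed set is the full subcomplex on the fixed vertices;
    contractibility thus becomes a question about a graph. *)
Lemma flag_fixed_points (H : set G) : fixed_points (X := flag_gcw) H =
  [set x : flag_point | forall w, x w != 0 -> forall h, H h -> aW h w = w].
Proof.
rewrite eqEsubset; split=> x /= xH.
  by move=> w xw h /xH /translation_fix; apply.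
by move=> h Hh; apply/translation_fix => w /xH; apply.
Qed.

Lemma flag_has_dimension n :
  (forall s, simplex adj s -> (#|` s| <= n.+1)%N) ->
  (exists2 s, simplex adj s & #|` s| = n.+1) ->
  has_dimension (gcw_cw flag_gcw) n.
Proof.
move=> dim_le [s ss sn]; split=> [[r rr]|].
  by rewrite /= /flag_dim -ltnS -(card_simplex rr); exact: dim_le.
by exists (exist _ s ss); rewrite /= /flag_dim /= sn.
Qed.

End FlagAction.
(** * Contractible subcomplexes *)

Section Contraction.
Local Open Scope ring_scope.
Variables (R : realType) (W : choiceType) (adj : W -> W -> Prop).
Variables (S : W -> Prop) (T : nat -> W -> W) (v0 : W).
Hypothesis adj_sym : forall v w, adj v w -> adj w v.
Hypotheses (S_v0 : S v0) (adj_v0 : adj v0 v0).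
Hypothesis S_T : forall n v, S v -> S (T n v).
Hypothesis T0 : forall v, S v -> T 0 v = v0.
Hypothesis T_stable : forall v, exists N, forall n, S v -> (N <= n)%N -> T n v = v.
Hypothesis adj_T : forall n v w, S v -> S w -> adj v w ->
  adj (T n v) (T n w) /\ adj (T n v) (T n.+1 w).
Local Notation flag_point := (flag_point R adj).
Implicit Types (x y : flag_point) (s : {fset W}) (v w : W) (t : R) (n k : nat).

(* Decreases from 1 to 0 on the interval [1/(k+2), 1/(k+1)], during which the
   homotopy moves from [T k.+1] to [T k].  As [T k] is eventually the identity
   on every simplex, the homotopy is continuous at time 0. *)
Definition ramp k t : R :=
  Num.max 0 (Num.min 1 (k.+2%:R * (1 - k.+1%:R * t))).

Lemma ramp_ge0 k t : 0 <= ramp k t.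
Proof. by rewrite le_max lexx. Qed.

Lemma ramp_le1 k t : ramp k t <= 1.
Proof. by rewrite ge_max ler01 ge_min lexx. Qed.

Lemma ramp1 k t : k.+2%:R * t <= 1 -> ramp k t = 1.
Proof.
move=> kt; have e : 1 <= k.+2%:R * (1 - k.+1%:R * t).
  have : 0 <= k.+1%:R :> R by [].
  by move: kt; rewrite -[k.+2%:R]natr1; nra.
by rewrite /ramp (min_l e) max_r ?ler01.
Qed.

Lemma ramp0 k t : 1 <= k.+1%:R * t -> ramp k t = 0.
Proof.
move=> kt; apply: max_l; rewrite ge_min; apply/orP; right.
by rewrite mulr_ge0_le0// subr_le0.
Qed.

Lemma continuous_ramp k : continuous (ramp k).
Proof.
have c : continuous (fun t => k.+2%:R * (1 - k.+1%:R * t)).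
  move=> t; apply: (@continuousM R R (fun=> k.+2%:R) (fun t => 1 - k.+1%:R * t)).
    exact: cst_continuous.
  apply: (@continuousB R R^o R (fun=> 1) (fun t => k.+1%:R * t)).
    exact: cst_continuous.
  by apply: (@continuousM R R (fun=> k.+1%:R) id); [exact: cst_continuous|].
move=> t; rewrite (_ : ramp k = (fun=> 0) \max ((fun=> 1) \min
  (fun t => k.+2%:R * (1 - k.+1%:R * t))))//.
apply: continuous_max; first exact: cst_continuous.
by apply: continuous_min; [exact: cst_continuous|exact: c].
Qed.

(** At a positive time at most one ramp is strictly between 0 and 1: [n] is the least index with
    [1 <= n.+2 * t]. *)
Lemma ramp_band t : 0 < t -> exists n,
  (forall k, (k < n)%N -> ramp k t = 1) /\ (forall k, (n < k)%N -> ramp k t = 0).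
Proof.
move=> t0; have /ex_minnP[n nt min_n] : exists n, 1 <= n.+2%:R * t.
  exists (Num.truncn t^-1); rewrite -ler_pdivrMr// div1r.
  apply: ltW; apply: lt_le_trans (truncnS_gt _) _.
  by rewrite ler_nat.
exists n; split=> k kn.
  by apply: ramp1; rewrite leNgt; apply: contraTN kn => /ltW /min_n; rewrite -leqNgt.
apply: ramp0; apply: le_trans nt _.
by rewrite ler_pM2r// ler_nat.
Qed.

Let N v := sval (cid (T_stable v)).

Let NP v n : S v -> (N v <= n)%N -> T n v = v.
Proof. by rewrite /N; case: cid => M /= h Sv; exact: h. Qed.

(** The coordinate at [w] of the trajectory of the vertex [v]. Written as a telescoping sum weighted
    by ramps it is visibly continuous in [t]; the terms beyond the stage [N v], after which [T] no
    longer moves [v], all vanish. *)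
Definition trace M v t w : R := (T 0 v == w)%:R +
  \sum_(0 <= k < M) ((T k.+1 v == w)%:R - (T k v == w)%:R) * ramp k t.

Lemma trace_widen M v t w : S v -> (N v <= M)%N -> trace M v t w = trace (N v) v t w.
Proof.
move=> Sv NM; rewrite /trace (@big_cat_nat _ _ _ (N v))//=.
rewrite [X in _ + (_ + X)]big_nat [X in _ + (_ + X)]big1 ?addr0// => k /andP[Nk _].
by rewrite !NP ?subrr ?mul0r// (leq_trans Nk).
Qed.

Lemma telescope_trace M v w : (T 0 v == w)%:R +
  \sum_(0 <= k < M) ((T k.+1 v == w)%:R - (T k v == w)%:R) = (T M v == w)%:R :> R.
Proof. by rewrite telescope_sumr// subrKC. Qed.

Lemma trace_band v t w n : S v ->
  (forall k, (k < n)%N -> ramp k t = 1) -> (forall k, (n < k)%N -> ramp k t = 0) ->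
  trace (N v) v t w =
  (1 - ramp n t) * (T n v == w)%:R + ramp n t * (T n.+1 v == w)%:R.
Proof.
move=> Sv r1 r0; rewrite -(@trace_widen (maxn (N v) n.+1)) ?leq_maxl//.
rewrite /trace (@big_cat_nat _ _ _ n.+1)//= ?leq_maxr//.
rewrite [X in _ + (_ + X)]big_nat [X in _ + (_ + X)]big1
  ?addr0 => [|k /andP[nk _]]; last first.
  by rewrite r0// mulr0.
rewrite big_nat_recr//= addrA (eq_big_nat _ _ (F2 := fun k =>
  (T k.+1 v == w)%:R - (T k v == w)%:R)) => [|k /andP[_ kn]]; last first.
  by rewrite r1// mulr1.
by rewrite telescope_trace; lra.
Qed.

Lemma trace_le0 v t w : S v -> t <= 0 -> trace (N v) v t w = (v == w)%:R.
Proof.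
move=> Sv t0; rewrite /trace.
under eq_bigr do rewrite ramp1 ?mulr1 ?(le_trans _ ler01)// ?mulr_ge0_le0//.
by rewrite telescope_trace NP.
Qed.

(** The simplex through which the image of [s] moves between the stages [n] and [n.+1]; the two
    adjacencies in [adj_T] make it a simplex. *)
Definition layer n s : {fset W} :=
  ([fset T n v | v in s] `|` [fset T n.+1 v | v in s])%fset.

Lemma simplex_layer n s :
  simplex adj s -> {in s, forall v, S v} -> simplex adj (layer n s).
Proof.
move=> [/fset0Pn[v vs] ss] Ss; split.
  by apply/fset0Pn; exists (T n v); rewrite inE in_imfset.
have aT u w (us : u \in s) (ws : w \in s) := adj_T n (Ss u us) (Ss w ws) (ss u w us ws).
have aT1 u w (us : u \in s) (ws : w \in s) := adj_T n.+1 (Ss u us) (Ss w ws) (ss u w us ws).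
move=> u w; rewrite !inE => /orP[] /imfsetP[/= u' us ->] /orP[] /imfsetP[/= w' ws ->].
- by case: (aT u' w').
- by case: (aT u' w').
- by apply: adj_sym; case: (aT w' u').
- by case: (aT1 u' w').
Qed.

(** All vertices of [s] share one stage and one parameter at time [t]. At nonpositive times, or when
    the stage of [t] exceeds [M], every vertex is stationary, and stage [M] with parameter 0
    serves. *)
Lemma trace_layer s M t : {in s, forall v, S v /\ (N v <= M)%N} ->
  exists n (l : R), [/\ (n <= M)%N, 0 <= l <= 1 & {in s, forall v w,
    trace (N v) v t w = (1 - l) * (T n v == w)%:R + l * (T n.+1 v == w)%:R}].
Proof.
move=> sM.
have at_M (v : W) w : v \in s -> (v == w)%:R =
    (1 - 0) * (T M v == w)%:R + 0 * (T M.+1 v == w)%:R :> R.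
  by move=> /sM[Sv NM]; rewrite NP// subr0 mul1r mul0r addr0.
have [t0|t0] := leP t 0.
  exists M, 0; split=> [//||v vs w]; first by rewrite lexx ler01.
  by rewrite trace_le0; [exact: at_M|case: (sM v vs)|].
have [n [r1 r0]] := ramp_band t0; have [nM|Mn] := leqP n M.
  exists n, (ramp n t); split=> [//||v vs w]; first by rewrite ramp_ge0 ramp_le1.
  by apply: trace_band; case: (sM v vs).
exists M, 0; split=> [//||v vs w]; first by rewrite lexx ler01.
have [Sv NM] := sM v vs; rewrite (trace_band _ Sv r1 r0).
have Nn := leq_trans NM (ltnW Mn).
rewrite (NP Sv Nn) (NP Sv (leqW Nn)) (NP Sv NM) (NP Sv (leqW NM)); lra.
Qed.

Definition homotopy_coord x t w : R := \sum_(v <- supp x) x v * trace (N v) v t w.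

Lemma homotopy_coordE s x t w : (supp x `<=` s)%fset ->
  homotopy_coord x t w = \sum_(v <- s) x v * trace (N v) v t w.
Proof.
move=> xs; apply: big_fset_incl => // v _.
by rewrite mem_supp negbK => /eqP ->; rewrite mul0r.
Qed.

Definition full_subcomplex := [set x : flag_point | forall w, x w != 0 -> S w].

(** The homotopy is extended linearly from the vertices. The bound on [n] does not depend on [t], so
    only finitely many layers occur over a given simplex. *)
Lemma homotopy_layer s M x t : simplex adj s ->
    {in s, forall v, S v /\ (N v <= M)%N} -> (supp x `<=` s)%fset ->
  exists2 n, (n <= M)%N & [/\ simplex adj (layer n s),
    forall w, w \notin layer n s -> homotopy_coord x t w = 0,
    forall w, 0 <= homotopy_coord x t w &
    \sum_(w <- layer n s) homotopy_coord x t w = 1].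
Proof.
move=> ss sM xs; have [n [l [nM /andP[l0 l1] tr]]] := trace_layer t sM.
exists n => //; split.
- by apply: simplex_layer => // v /sM[].
- move=> w wn; rewrite (homotopy_coordE _ _ xs) big_seq big1// => v vs.
  have n1 : (T n v == w) = false.
    apply: negbTE; apply: contraNN wn => /eqP <-.
    by rewrite in_fsetU (in_imfset _ (T n)).
  have n2 : (T n.+1 v == w) = false.
    apply: negbTE; apply: contraNN wn => /eqP <-.
    by rewrite in_fsetU (in_imfset _ (T n.+1)) ?orbT.
  by rewrite (tr v vs) n1 n2 !mulr0 addr0 mulr0.
- move=> w; rewrite (homotopy_coordE _ _ xs) big_seq; apply: sumr_ge0 => v vs.
  rewrite mulr_ge0 ?coord_ge0// (tr v vs).
  by rewrite addr_ge0// mulr_ge0// ?ler0n// subr_ge0.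
- rewrite (eq_bigr _ (fun w _ => homotopy_coordE t w xs)) exchange_big /=.
  rewrite -[RHS](sum_coord xs) big_seq [RHS]big_seq; apply: eq_bigr => v vs.
  rewrite -mulr_sumr (eq_bigr _ (fun w _ => tr v vs w)) big_split /= -!mulr_sumr.
  have one u : u \in layer n s -> \sum_(w <- layer n s) (u == w)%:R = 1 :> R.
    move=> un; rewrite (big_fsetD1 u)//= eqxx big_seq big1 ?addr0// => w.
    by rewrite !inE eq_sym => /andP[/negPf ->].
  rewrite one ?in_fsetU ?(in_imfset _ (T n))//.
  rewrite one ?in_fsetU ?(in_imfset _ (T n.+1)) ?orbT//.
  by rewrite !mulr1 subrK mulr1.
Qed.

Let bound s := (\max_(v <- s) N v)%N.

Lemma S_supp x : full_subcomplex x -> {in supp x, forall v, S v}.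
Proof. by move=> xS v; rewrite mem_supp; exact: xS. Qed.

Let bound_ge s v : v \in s -> (N v <= bound s)%N.
Proof. by move=> vs; exact: leq_bigmax_seq. Qed.

Lemma homotopy_barycentric x t : full_subcomplex x -> barycentric adj (homotopy_coord x t).
Proof.
move=> /S_supp xS; have [|n _ [? ? ? ?]] :=
  @homotopy_layer (supp x) (bound (supp x)) x t (simplex_supp x) _ (fsubset_refl _).
  by move=> v vx; split; [exact: xS|exact: bound_ge].
by exists (layer n (supp x)).
Qed.

(** Off the subcomplex the coordinates may fail to be barycentric; the value there is the default
    [z.1]. *)
Definition homotopy (z : flag_point * R) : flag_point :=
  if pselect (barycentric adj (homotopy_coord z.1 z.2)) is left h then Point h
  else z.1.

Lemma homotopyE x t w : full_subcomplex x -> homotopy (x, t) w = homotopy_coord x t w.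
Proof.
by move=> /homotopy_barycentric xS; rewrite /homotopy; case: pselect => // /(_ (xS t)).
Qed.

Lemma homotopy_S x t : full_subcomplex x -> full_subcomplex (homotopy (x, t)).
Proof.
move=> xS w; rewrite homotopyE//; apply: contraNP => Sw.
rewrite /homotopy_coord big_seq big1// => v vx; have Sv := S_supp xS vx.
have Tw k : (T k v == w) = false.
  by apply/negP => /eqP Tv; apply: Sw; rewrite -Tv; exact: S_T.
by rewrite /trace Tw add0r big1 ?mulr0// => k _; rewrite !Tw subrr mul0r.
Qed.

Lemma homotopy0 x : full_subcomplex x -> homotopy (x, 0) = x.
Proof.
move=> xS; apply: point_ext => w; rewrite homotopyE// /homotopy_coord.
rewrite big_seq (eq_bigr (fun v => x v * (v == w)%:R)) => [|v vx]; last first.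
  by rewrite trace_le0//; exact: S_supp vx.
rewrite -big_seq; have [wx|wx] := boolP (w \in supp x).
  rewrite (big_fsetD1 w)//= eqxx mulr1 big_seq big1 ?addr0// => v.
  by rewrite !inE => /andP[/negPf ->]; rewrite mulr0.
rewrite big_seq big1 => [|v vx]; first by move: wx; rewrite mem_supp negbK => /eqP.
by have [vw|_] := eqVneq v w; [rewrite -vw vx in wx|rewrite mulr0].
Qed.

Lemma base_barycentric : barycentric adj (fun w => (v0 == w)%:R : R).
Proof.
exists [fset v0]%fset; split.
- split; first by apply/fset0Pn; exists v0; rewrite inE.
  by move=> v w; rewrite !inE => /eqP -> /eqP ->.
- by move=> w; rewrite inE eq_sym => /negPf ->.
- by move=> w; exact: ler0n.
- by rewrite big_seq_fset1 eqxx.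
Qed.

Lemma homotopy1 x : full_subcomplex x -> homotopy (x, 1) = Point base_barycentric.
Proof.
move=> xS; apply: point_ext => w; rewrite homotopyE// /homotopy_coord.
rewrite big_seq (eq_bigr (fun v => x v * (v0 == w)%:R)) => [|v vx]; last first.
  have Sv := S_supp xS vx; rewrite /trace (T0 Sv) big1 ?addr0// => k _.
  by rewrite ramp0 ?mulr0// mulr1 ler1n.
by rewrite -big_seq -mulr_suml sum_coord ?mul1r.
Qed.

(* On a fixed simplex, [homotopy] runs through finitely many simplices. *)
Lemma homotopy_cvg s x t : full_subcomplex x -> simplex adj s -> (supp x `<=` s)%fset ->
  homotopy (z.2, z.1) @[z --> within [set z | full_subcomplex z.2]
    (filter_prod (nbhs t) (simplex_nbhs s x))] --> homotopy (x, t).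
Proof.
move=> xS ss xs; pose s' := [fset v in s | `[< S v >]]%fset.
have subs' y : full_subcomplex y -> (supp y `<=` s)%fset -> (supp y `<=` s')%fset.
  move=> yS /fsubsetP ys; apply/fsubsetP => v vy; rewrite !inE/= ys//=.
  by apply/asboolP; exact: S_supp vy.
have s's : (s' `<=` s)%fset by apply/fsubsetP => v; rewrite !inE => /andP[].
have xs' := subs' x xS xs.
have ss' : simplex adj s'.
  apply: simplex_sub ss s's _; apply/fset0Pn.
  by have /fset0Pn[w wx] := supp_neq0 x; exists w; exact: (fsubsetP xs').
have bs' : {in s', forall v, S v /\ (N v <= bound s')%N}.
  by move=> v vs; split; [move: vs; rewrite !inE => /andP[_ /asboolP]|exact: bound_ge].
have sF : \forall z \near filter_prod (nbhs t) (simplex_nbhs s x), (supp z.2 `<=` s)%fset.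
  by exists (setT, [set y | (supp y `<=` s)%fset]) => [|[u y] [_]//]; split=> /=;
    [exact: filterT|exists 1].
pose ls := [seq layer n s' | n <- iota 0 (bound s').+1].
have mem_ls n : (n <= bound s')%N -> layer n s' \in ls.
  by move=> nM; apply: (map_f (fun n => layer n s')); rewrite mem_iota.
apply: (@cvg_point _ _ _ _ _ _ _ _ ls).
- by move=> r /mapP[n _ ->]; apply: simplex_layer => // v /bs'[].
- rewrite /prop_near1 /within; apply: filterS sF => -[u y] /= ys yS.
  have [n nM [_ h0 _ _]] := homotopy_layer u ss' bs' (subs' y yS ys).
  exists (layer n s'); first exact: mem_ls.
  by apply/supp_sub => w; rewrite homotopyE//; exact: h0.
- move=> w; rewrite homotopyE// (homotopy_coordE _ _ xs').
  have : (fun z : R * flag_point => \sum_(v <- s') z.2 v * trace (N v) v z.1 w) @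
      filter_prod (nbhs t) (simplex_nbhs s x) -->
      \sum_(v <- s') x v * trace (N v) v t w.
    apply: cvg_big => [|v _]; first exact: add_continuous.
    apply: (@cvgM R _ _ _ (fun z : R * flag_point => z.2 v)
      (fun z : R * flag_point => trace (N v) v z.1 w)).
      exact: (@cvg_comp (R * flag_point)%type flag_point R snd (fun y : flag_point => y v) _
        (simplex_nbhs s x) _ cvg_snd (simplex_nbhs_coord xs)).
    apply: (@cvg_comp (R * flag_point)%type R R fst (fun u => trace (N v) v u w) _
      (nbhs t) _ cvg_fst).
    apply: cvgD; first exact: cvg_cst.
    apply: cvg_big => [|k _]; first exact: add_continuous.
    by apply: cvgM; [exact: cvg_cst|exact: continuous_ramp].
  move=> h U /h; rewrite /within /= !nbhs_simpl; apply: filterS2 sF => -[u y] /= ys + yS.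
  by rewrite homotopyE// (homotopy_coordE _ _ (subs' y yS ys)).
Qed.

(** A tube argument passes from convergence on each simplex to the product topology: the set [V] of
    points whose trajectory over the compact interval [J] stays in [B] is open for the weak
    topology. *)
Lemma homotopy_continuous :
  {within full_subcomplex `*` `[0, 1], continuous homotopy}.
Proof.
apply/subspace_continuousP => -[x t] [/= xS _] U [B [oB Bx BU]].
have nB y u : B (homotopy (y, u)) -> nbhs (homotopy (y, u)) B.
  by move=> Byu; apply: open_nbhs_nbhs; split.
have : \forall u \near t, B (homotopy (x, u)).
  have [[A C] /= [tA [e e0 eC]] AC] :=
    homotopy_cvg xS (simplex_supp x) (fsubset_refl _) (nB _ _ Bx).
  apply: filterS tA => u Au; apply: (AC (u, x)) => //; split=> //=.
  by apply: eC => // w _; rewrite subrr normr0.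
move=> /nbhs_ballP[d /= d0 dB].
pose J := `[t - d / 2, t + d / 2]%classic.
pose V := [set y | full_subcomplex y -> forall u, J u -> B (homotopy (y, u))].
have Vx : V x.
  move=> _ u; rewrite /J /= in_itv /= => /andP[u1 u2]; apply: dB.
  by rewrite /ball /= ltr_distlC; apply/andP; split; lra.
have oV : open V.
  rewrite point_openE => y s Vy ss ys.
  have [yS|yS] := pselect (full_subcomplex y); last first.
    (* A coordinate at a vertex outside [S] stays nonzero near [y], so no nearby point of [s] is in
       the subcomplex and the condition is vacuous. *)
    have [w /not_implyP[yw Sw]] : exists w, ~ (y w != 0 -> S w) by exact/existsNP.
    have y0 : 0 < y w by rewrite lt_neqAle eq_sym yw coord_ge0.
    exists (y w) => // z zs /(_ w); rewrite (fsubsetP ys) ?mem_supp// => /(_ isT) zw zS.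
    exfalso; apply/Sw/zS; apply: contraTneq zw => ->.
    by rewrite sub0r normrN gtr0_norm// ltxx.
  have nJ := (compact_near_coveringP _).1 (@segment_compact R (t - d / 2) (t + d / 2)).
  have := nJ _ (simplex_nbhs s y)
    (fun z u => full_subcomplex z -> B (homotopy (z, u))) (simplex_nbhs_filter s y).
  have h u : J u -> \forall u' \near u & z \near simplex_nbhs s y,
      full_subcomplex z -> B (homotopy (z, u')).
    by move=> Ju; exact: (homotopy_cvg yS ss ys (nB _ _ (Vy yS u Ju))).
  by move=> /(_ h); apply: filterS => z zJ zS u Ju; exact: zJ.
exists (V, ball t (d / 2)).
  by split; [exists V; split|apply: nbhsx_ballx; rewrite divr_gt0].
move=> [y u] [/= Vy]; rewrite /ball /= ltr_distlC => /andP[u1 u2] [yS _].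
by apply/BU/Vy => //; rewrite /J /= in_itv /= (ltW u1) (ltW u2).
Qed.

(** The maps [T n] interpolate between the constant [v0] at stage 0 and, eventually on each vertex,
    the identity; the homotopy runs through the stages in decreasing order. *)
Lemma contractible_full_subcomplex : contractible R full_subcomplex.
Proof.
exists (Point base_barycentric); split.
  by move=> w /=; have [<-|] := eqVneq v0 w; rewrite //= eqxx.
exists homotopy; split.
- exact: homotopy_continuous.
- by move=> x t xS _; exact: homotopy_S.
- exact: homotopy0.
- exact: homotopy1.
Qed.

End Contraction.

(** * Contractibility of rooted trees *)

Section RootedTree.
Local Open Scope ring_scope.
Variables (R : realType) (W : choiceType) (adj : W -> W -> Prop).
Variables (S : W -> Prop) (P : W -> W) (v0 : W).
Hypothesis adj_sym : forall v w, adj v w -> adj w v.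
Hypothesis adj_refl : forall v, S v -> adj v v.
Hypotheses (S_v0 : S v0) (P_v0 : P v0 = v0).
Hypothesis S_P : forall v, S v -> S (P v).
Hypothesis adj_P : forall v, S v -> adj v (P v).
Hypothesis P_reach : forall v, S v -> exists n, iter n P v = v0.
Hypothesis tree_adj : forall v w, S v -> S w -> adj v w ->
  [\/ v = w, w = P v | v = P w].

Definition depth v : nat :=
  if pselect (exists n, iter n P v == v0) is left h then ex_minn h else 0.

Lemma depthP v : S v -> iter (depth v) P v = v0 /\
  forall n, iter n P v = v0 -> (depth v <= n)%N.
Proof.
move=> /P_reach[n nv]; rewrite /depth; case: pselect => [h|[]]; last first.
  by exists n; exact/eqP.
by case: ex_minnP => d /eqP dv min_d; split=> // k /eqP; exact: min_d.
Qed.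

Lemma depth_P v : S v -> depth (P v) = (depth v).-1.
Proof.
move=> Sv; have [dv min_d] := depthP Sv; have [dPv min_dP] := depthP (S_P Sv).
case E : (depth v) dv min_d => [|d] dv min_d.
  by apply/eqP; rewrite -leqn0; apply: min_dP; rewrite /= in dv *; rewrite dv P_v0.
apply/eqP; rewrite eqn_leq min_dP -?iterSr//=.
by have := min_d (depth (P v)).+1; rewrite iterSr ltnS; apply.
Qed.

(** The first vertex at depth at most [n] on the path from [v] to the root; it plays the role of the
    stage [T n]. *)
Definition ancestor n v := iter (depth v - n) P v.

Lemma S_ancestor n v : S v -> S (ancestor n v).
Proof. by rewrite /ancestor => Sv; elim: (_ - _)%N => //= k; exact: S_P. Qed.

Lemma ancestor_id n v : (depth v <= n)%N -> ancestor n v = v.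
Proof. by rewrite /ancestor -subn_eq0 => /eqP ->. Qed.

Lemma ancestor_P n v : S v -> (n < depth v)%N -> ancestor n (P v) = ancestor n v.
Proof.
move=> Sv nv; rewrite /ancestor depth_P// -iterSr.
by congr (iter _ P v); lia.
Qed.

Lemma adj_ancestorS n v : S v -> adj (ancestor n v) (ancestor n.+1 v).
Proof.
move=> Sv; have [dn|nd] := leqP (depth v) n.
  by rewrite !ancestor_id ?(leqW dn)//; exact: adj_refl.
apply: adj_sym; rewrite {2}/ancestor (_ : depth v - n = (depth v - n.+1).+1)%N; last by lia.
exact/adj_P/S_ancestor.
Qed.

(** Adjacent vertices are equal or parent and child. Beyond depth [n] a parent and its child have
    the same ancestor at stage [n], so only the vertices near that depth need care. *)
Lemma adj_ancestor n v w : S v -> S w -> adj v w ->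
  adj (ancestor n v) (ancestor n w) /\ adj (ancestor n v) (ancestor n.+1 w).
Proof.
move=> Sv Sw /(tree_adj Sv Sw)[<-|->|->].
- by split; [exact/adj_refl/S_ancestor|exact: adj_ancestorS].
- have [dn|nd] := leqP (depth v) n.
    by rewrite !ancestor_id ?depth_P//; [split; exact: adj_P|lia..].
  split; first by rewrite ancestor_P//; exact/adj_refl/S_ancestor.
  have [nd'|dn] := ltnP n.+1 (depth v).
    by rewrite ancestor_P//; exact: adj_ancestorS.
  rewrite -(ancestor_P Sv nd) !ancestor_id ?depth_P//; [|lia..].
  exact/adj_refl/S_P.
- have [dn|nd] := leqP (depth w) n.
    rewrite !ancestor_id ?depth_P//; [|lia..].
    by split; apply: adj_sym; exact: adj_P.
  rewrite ancestor_P//.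
  by split; [exact/adj_refl/S_ancestor|exact: adj_ancestorS].
Qed.

(* Retracting the tree onto the balls of decreasing radius around the root. *)
Lemma contractible_rooted_tree : contractible R (@full_subcomplex R W adj S).
Proof.
apply: (@contractible_full_subcomplex R W adj S ancestor v0) => //.
- exact: adj_refl.
- exact: S_ancestor.
- by move=> v Sv; rewrite /ancestor subn0; case: (depthP Sv).
- by move=> v; exists (depth v) => n _; exact: ancestor_id.
- exact: adj_ancestor.
Qed.

End RootedTree.
(** * Virtually nilpotent subgroups of abelian-by-cyclic groups *)

Section Commutators.
Local Open Scope group_scope.
Variable G : groupType.
Implicit Types x y z : G.

Lemma commMg x y z : [~ x * y, z] = [~ x, z] ^ y * [~ y, z].
Proof. by rewrite !commgEl !conjgE invgM !mulgA !mulgK. Qed.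

Lemma commgM x y z : [~ x, y * z] = [~ x, z] * [~ x, y] ^ z.
Proof. by rewrite !commgEl !conjgE invgM !mulgA !mulgK. Qed.

Lemma commVg x y : [~ x^-1, y] = ([~ x, y]^-1) ^ x^-1.
Proof.
by apply: (@mulgI _ ([~ x, y] ^ x^-1)); rewrite -conjMg mulgV conj1g -commMg mulgV comm1g.
Qed.

Lemma commgV x y : [~ x, y^-1] = ([~ x, y]^-1) ^ y^-1.
Proof.
by apply: (@mulIg _ ([~ x, y] ^ y^-1)); rewrite -conjMg mulVg conj1g -commgM mulgV commg1.
Qed.

End Commutators.

(** * The projection of the semi-direct product onto the integers *)

Section LevelMap.
Local Open Scope group_scope.
Variables (G : groupType) (A T : set G).
Hypothesis GAT : semidirect_product A T.
Hypothesis T_cyclic : infinite_cyclic T.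

(** The level of [g] is the [n] with [g / f n] in [A]; it is unique because [A] meets [T] trivially
    and [f] is injective. *)
Lemma level_map_exists : exists eps : G -> int,
  [/\ forall x y, eps (x * y) = (eps x + eps y)%R,
      forall x, A x <-> eps x = 0%R & exists t, eps t = 1%R].
Proof.
have [[sA nA] sT AT AxT] := GAT; have [f [f_inj fD fT]] := T_cyclic.
have TE n : T (f n) by rewrite -fT; exists n.
have f0 : f 0%R = 1 by apply: (@mulgI _ (f 0%R)); rewrite -fD addr0 mulg1.
have A1 : A 1 by case/subgroupP: sA.
have Aconj x g : A x -> A (x ^ g) by move=> Ax; rewrite -(nA g); exists x.
have ex g : exists n, A (g / f n).
  have : [set n * k | n in A & k in T] g by rewrite AxT.
  by move=> [a Aa [k]]; rewrite -fT => -[n _ <-] <-; exists n; rewrite mulgK.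
have uniq g n m : A (g / f n) -> A (g / f m) -> n = m.
  move=> An Am; apply: f_inj; apply: divg1_eq.
  suff : (A `&` T) (f n / f m) by rewrite AT.
  split; last by apply: subgroupM => //; exact: subgroupV.
  have := subgroupM sA (subgroupV sA An) Am.
  by rewrite invgF mulgA mulgVK.
have [eps epsP] := choice ex; exists eps; split.
- move=> x y; apply: uniq (epsP _) _.
  have -> : x * y / f (eps x + eps y)%R =
      (x / f (eps x)) * (y / f (eps y)) ^ (f (eps x))^-1.
    by rewrite fD conjgE invgK invgM !mulgA mulgVK.
  by apply: subgroupM => //; exact: Aconj.
- move=> x; split=> [Ax|e]; last by have := epsP x; rewrite e f0 divg1.
  by apply: uniq (epsP x) _; rewrite f0 divg1.
- by exists (f 1%R); apply: uniq (epsP _) _; rewrite mulgV.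
Qed.

End LevelMap.

(** * The chain of subgroups detecting virtual nilpotence *)

Section NilpotentChain.
Local Open Scope group_scope.
Variables (G : groupType) (eps : G -> int).
Hypothesis epsM : forall x y, eps (x * y) = (eps x + eps y)%R.
Implicit Types (x y g h b : G) (i j m n : nat) (H L : set G).

Lemma eps1 : eps 1 = 0%R.
Proof. by have := epsM 1 1; rewrite mulg1; lia. Qed.

Lemma epsV x : eps x^-1 = (- eps x)%R.
Proof. by have := epsM x x^-1; rewrite mulgV eps1; lia. Qed.

Lemma epsJ x y : eps (x ^ y) = eps x.
Proof. by rewrite conjgE !epsM epsV; lia. Qed.

Lemma epsR x y : eps [~ x, y] = 0%R.
Proof. by rewrite commgEl epsM epsJ epsV; lia. Qed.

Lemma epsX x n : eps (x ^+ n) = (n%:Z * eps x)%R.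
Proof.
by elim: n => [|n IH]; rewrite ?expg0 ?eps1 ?expgS ?epsM ?IH; lia.
Qed.

(** Commutators with all elements of level [(j.+1)!] are required, rather than with one power of
    [t]; this makes invariance under conjugation immediate, since conjugation preserves levels. For
    abelian [A] the two conditions agree by [chain_comm_eps]. *)
Fixpoint chain i : set G := if i is j.+1 then
    [set b | eps b = 0%R /\
      forall g, eps g = (j.+1)`!%:Z%R -> chain j [~ b, g]]
  else [set 1].

Global Arguments chain : simpl never.

Lemma chain_eps i b : chain i b -> eps b = 0%R.
Proof. by case: i => [->|i []//]; exact: eps1. Qed.

Lemma chain_normal i : [/\ chain i 1,
  forall x y, chain i x -> chain i y -> chain i (x * y),
  forall x, chain i x -> chain i x^-1 &
  forall x g, chain i x -> chain i (x ^ g)].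
Proof.
elim: i => [|i [K1 KM KV KJ]]; rewrite /chain -/chain.
  split=> //= [x y -> ->|x ->|x g ->]; rewrite ?mulg1 ?invg1 ?conj1g//.
split=> [|x y [x0 xK] [y0 yK]|x [x0 xK]|x g [x0 xK]].
- by split=> [|g _]; rewrite ?eps1 ?comm1g.
- split=> [|g eg]; first by rewrite epsM x0 y0.
  by rewrite commMg; apply: KM; [apply: KJ; exact: xK|exact: yK].
- split=> [|g eg]; first by rewrite epsV x0.
  by rewrite commVg; apply/KJ/KV/xK.
- split=> [|h eh]; first by rewrite epsJ.
  by rewrite -[h](conjgKV g) -conjRg; apply/KJ/xK; rewrite epsJ.
Qed.

Lemma chain1 i : chain i 1. Proof. by case: (chain_normal i). Qed.

Lemma chainM i x y : chain i x -> chain i y -> chain i (x * y).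
Proof. by case: (chain_normal i) => _ KM _ _; exact: KM. Qed.

Lemma chainV i x : chain i x -> chain i x^-1.
Proof. by case: (chain_normal i) => _ _ KV _; exact: KV. Qed.

Lemma chainJ i x g : chain i x -> chain i (x ^ g).
Proof. by case: (chain_normal i) => _ _ _ KJ; exact: KJ. Qed.

Lemma chainJr i x g : chain i (x ^ g) -> chain i x.
Proof. by move=> /(chainJ g^-1); rewrite conjgK. Qed.

Lemma chain_commC i x y : chain i [~ x, y] -> chain i [~ y, x].
Proof. by move=> /chainV; rewrite invgR. Qed.

Lemma chainR i x g : chain i x -> chain i [~ x, g].
Proof. by move=> Kx; rewrite commgEl; apply: chainM; [exact: chainV|exact: chainJ]. Qed.

Lemma chain_le i j : (i <= j)%N -> chain i `<=` chain j.
Proof.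
elim: j => [|j IH]; first by rewrite leqn0 => /eqP ->.
rewrite leq_eqVlt => /orP[/eqP ->//|/IH ij] x /ij Kx.
by split=> [|g _]; [exact: chain_eps Kx|exact: chainR].
Qed.

Lemma chain_commM i x g h :
  chain i [~ x, g] -> chain i [~ x, h] -> chain i [~ x, g * h].
Proof. by move=> Kg Kh; rewrite commgM; apply: chainM => //; exact: chainJ. Qed.

Lemma chain_commX i x g n : chain i [~ x, g] -> chain i [~ x, g ^+ n].
Proof.
move=> Kg; elim: n => [|n IH]; first by rewrite expg0 commg1; exact: chain1.
by rewrite expgS; exact: chain_commM.
Qed.

Lemma chain_commV i x g : chain i [~ x, g^-1] <-> chain i [~ x, g].
Proof.
split=> [|Kg]; last by rewrite commgV; exact/chainJ/chainV.
by rewrite commgV => /chainJr /chainV; rewrite invgK.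
Qed.

Hypothesis A_comm : forall x y, eps x = 0%R -> eps y = 0%R -> commute x y.

(** The elements [h] and [g ^ z] differ by an element of level 0, which commutes with [b]. *)
Lemma chain_comm_eps i b g h (z : int) : eps b = 0%R -> chain i [~ b, g] ->
  eps h = (z * eps g)%R -> chain i [~ b, h].
Proof.
move=> b0 Kg.
have pos n h' : eps h' = (n%:Z * eps g)%R -> chain i [~ b, h'].
  move=> h'E; rewrite -[h'](mulgVK (g ^+ n)); apply: chain_commM; last exact: chain_commX.
  have -> : [~ b, h' / g ^+ n] = 1; last exact: chain1.
  by apply/eqP/commgP/A_comm; rewrite // epsM epsV epsX h'E; lia.
case: z => n hE; first exact: pos hE.
by apply/chain_commV; apply: (pos n.+1); rewrite epsV hE; lia.
Qed.

(** A positive level of at most [j.+1] divides [(j.+1)!], so commuting with [g] modulo [K_i] gives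
    the same for every element of level [(j.+1)!]. *)
Lemma chain_up i j b g : (i <= j)%N -> eps b = 0%R ->
  (0 < eps g <= j.+1%:Z)%R -> chain i [~ b, g] -> chain j.+1 b.
Proof.
move=> ij b0 /andP[g0 gj] Kg; split=> // h hE.
have /dvdnP[n nE] : (`|eps g| %| j.+1`!)%N by apply: dvdn_fact; lia.
apply: chain_le ij _ _; apply: (@chain_comm_eps _ _ _ _ n%:Z%R b0 Kg).
by rewrite hE nE PoszM; lia.
Qed.

Lemma abelian_virtually_nilpotent H :
  subgroup H -> (forall h, H h -> eps h = 0%R) -> virtually_nilpotent H.
Proof.
move=> sH H0; have [H1 _] := (subgroupP H).1 sH; exists H; split=> //.
  exists 1%N => /=; rewrite eqEsubset; split=> [|_ ->]; last first.
    by case: ((subgroupP _).1 (subgroup_smallest [set [~ h, k] | h in H & k in H])).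
  apply: smallest_sub.
    by apply/subgroupP; split=> // x y -> ->; rewrite mulgV.
  by move=> _ [x /H0 x0 [y /H0 y0 <-]]; apply/eqP/commgP/A_comm.
apply: (@sub_finite_set _ _ [set H]); last exact: finite_set1.
move=> _ [h Hh <-] /=; rewrite eqEsubset; split=> [_ [x Hx <-]|x Hx].
  exact: subgroupM.
exists (h^-1 * x); last by rewrite mulVKg.
by apply: subgroupM => //; exact: subgroupV.
Qed.

(** [N] is the number of cosets. It does not depend on the sequence [f], which later gives one bound
    for all [b] in [H]. *)
Lemma finite_index_pigeonhole H L : subgroup L -> finite_index L H ->
  exists N, forall f : nat -> G, (forall k, H (f k)) ->
    exists k l, [/\ (k < l)%N, (l <= N)%N & L ((f k)^-1 * f l)].
Proof.
move=> sL /finite_seqP[s sE]; exists (size s) => f Hf.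
pose c k := lcoset (f k) L.
have /(uniqPn set0)[k [l [kl]]] : ~~ uniq [seq c k | k <- iota 0 (size s).+1].
  have sub : {subset [seq c k | k <- iota 0 (size s).+1] <= s}.
    move=> _ /mapP[k _ ->]; have : [set` s] (c k) by rewrite -sE; exists (f k); first exact: Hf.
    by [].
  apply: contraT => /negPn u.
  by have := uniq_leq_size u sub; rewrite size_map size_iota ltnn.
rewrite size_map size_iota ltnS => lN.
rewrite !(nth_map 0%N) ?size_iota// ?nth_iota//; try by rewrite ltnS ?(leq_trans (ltnW kl)).
rewrite !add0n => ckl; exists k, l; split=> //.
have : c l (f l) by exists 1; [case: ((subgroupP L).1 sL)|rewrite mulg1].
by rewrite -ckl => -[x Lx <-]; rewrite mulKg.
Qed.

(** Descending induction along the lower central series of [L] places the level 0 elements of [L] in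
    [K_(m + c)]. For [b] in [H], two of the conjugates of [b] by powers of [g] lie in one coset of
    [L]; their quotient is a commutator in [L] with a power of [g] of level at most [m * N]. *)
Lemma virtually_nilpotent_chain H g0 : subgroup H -> virtually_nilpotent H ->
  H g0 -> eps g0 <> 0%R -> exists i, forall b, H b -> eps b = 0%R -> chain i b.
Proof.
move=> sH [L [sL LH [c Lc] fL]] Hg0 eg0.
have [N NP] := finite_index_pigeonhole sL fL.
have HX x n : H x -> H (x ^+ n).
  move=> Hx; elim: n => [|n IH]; first by case: ((subgroupP H).1 sH).
  by rewrite expgS; exact: subgroupM.
(* By the pigeonhole principle some nontrivial power of [g0] lies in [L]; inverting if necessary
   makes its level positive. *)
have [g Lg g_gt0] : exists2 g, L g & (0 < eps g)%R.
  have [k [l [kl _]]] := NP (fun k => g0 ^+ k) (HX g0 ^~ Hg0).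
  rewrite -(subnKC (ltnW kl)) expgnDr mulKg => Lg.
  have ne0 : eps (g0 ^+ (l - k)) <> 0%R by rewrite epsX; nia.
  have [gt0|le0] := ltP 0%R (eps (g0 ^+ (l - k))); first by exists (g0 ^+ (l - k)).
  by exists (g0 ^+ (l - k))^-1; [exact: subgroupV|rewrite epsV; lia].
pose m := `|eps g|%N; have gm : eps g = m%:Z%R by rewrite /m gtz0_abs.
(* The offset [m] keeps the level of [g] within the bound required by [chain_up] at each step. *)
have Lchain k p x : (p + k)%N = c -> lower_central L p x -> eps x = 0%R ->
    chain (m + k) x.
  elim: k p x => [|k IH] p x.
    by rewrite addn0 => ->; rewrite Lc => -> _; exact: chain1.
  rewrite addnS -addSn => pc Lx x0; rewrite addnS; apply: (@chain_up (m + k) _ _ g) => //.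
    by rewrite g_gt0 gm; lia.
  apply: (IH _ _ pc); last exact: epsR.
  by apply: sub_gen_smallest; exists x => //; exists g.
exists (maxn (m + c) (m * N)).+1 => b Hb b0.
have Hg := LH _ Lg.
have [|k [l [kl lN]]] := NP (fun k => b ^ (g ^+ k)).
  have Hgk k := HX g k Hg; move=> k; rewrite conjgE.
  by apply: subgroupM => //; [exact: subgroupV|exact: subgroupM].
rewrite -(subnKC (ltnW kl)) expgnDr conjgM -commgEl => Lb.
apply: (@chainJr _ _ (g ^+ k)).
apply: (@chain_up (m + c) _ _ (g ^+ (l - k))); rewrite ?leq_maxl ?epsJ//.
  have m0 : (0 < m)%N by lia.
  have : ((l - k) * m <= m * N)%N by rewrite mulnC leq_mul2l (leq_trans (leq_subr _ _) lN) orbT.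
  have : (0 < (l - k) * m)%N by rewrite muln_gt0 subn_gt0 kl.
  rewrite epsX gm -PoszM; lia.
by apply: (Lchain c 0) => //; exact: epsR.
Qed.

Variable t : G.
Hypothesis eps_t : eps t = 1%R.

Lemma chain_down i b g (z : int) :
  chain i.+1 b -> eps g = (z * (i.+1)`!%:Z)%R -> chain i [~ b, g].
Proof.
move=> [b0 Kb] gE; apply: (@chain_comm_eps _ _ (t ^+ (i.+1)`!) _ z b0).
  by apply: Kb; rewrite epsX eps_t mulr1.
by rewrite gE epsX eps_t mulr1.
Qed.

(** The elements of [H] of level divisible by [i!] form a subgroup [L] of finite index. Its derived
    subgroup lies in [K_i], and each further commutator with [L] descends one step, because [k!]
    divides [i!] for [k] at most [i]. *)
Lemma chain_virtually_nilpotent H i : subgroup H ->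
  (forall b, H b -> eps b = 0%R -> chain i b) -> virtually_nilpotent H.
Proof.
move=> sH HK; pose q : int := i`!%:Z%R.
pose L := [set g | H g /\ (q %| eps g)%Z].
have sL : subgroup L.
  apply/subgroupP; split.
    by split; [case: ((subgroupP H).1 sH)|rewrite eps1 dvdz0].
  move=> x y [Hx qx] [Hy qy]; split.
    by apply: subgroupM => //; exact: subgroupV.
  by rewrite epsM epsV rpredB.
have lcL n : lower_central L n.+1 `<=` chain (i - n)%N.
  elim: n => [|n IH].
    move=> x xL; rewrite subn0; apply: HK.
      have : lower_central L 1%N `<=` H.
        apply: smallest_sub => // _ [y [Hy _] [z [Hz _] <-]].
        by rewrite commgEl conjgE; do !apply: subgroupM => //; exact: subgroupV.
      exact.
    have : lower_central L 1%N `<=` [set y | eps y = 0%R].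
      apply: smallest_sub => [|_ [y _ [z _ <-]]]; last exact: epsR.
      by apply/subgroupP; split=> /= [|y z y0 z0]; rewrite ?eps1 ?epsM ?epsV ?y0 ?z0.
    exact.
  apply: smallest_sub.
    apply/subgroupP; split=> [|x y Kx Ky]; first exact: chain1.
    by apply: chainM => //; exact: chainV.
  move=> _ [x /IH Kx [y [_ /dvdzP[z yE]] <-]].
  rewrite subnS; case E : (i - n)%N Kx => [|k] /= Kx.
    by rewrite Kx comm1g.
  have /dvdnP[r rE] : (k.+1`! %| i`!)%N.
    have ki : (k < i)%N by lia.
    by rewrite -(bin_fact ki) mulnCA dvdn_mulr.
  by apply: (@chain_down _ _ _ (z * r%:Z)%R Kx); rewrite yE /q rE PoszM mulrA.
exists L; split=> //; first by move=> x [].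
  exists i.+1; rewrite eqEsubset; split=> [x /lcL|_ ->].
    by rewrite subnn.
  by case: ((subgroupP _).1 (subgroup_lower_central i.+1 sL)).
(* The cosets of [L] in [H] are indexed by the residues of levels modulo [i!]; the default 1
   concerns residues that [H] does not attain. *)
pose rep n := lcoset (xget 1 [set h | H h /\ (eps h %% q)%Z = n%:Z%R]) L.
apply: (@sub_finite_set _ _ (rep @` `I_(i`!))); last exact/finite_image/finite_II.
move=> _ [h Hh <-].
have q0 : (0 < q)%R by rewrite /q ltz_nat fact_gt0.
have [r rE] : exists r : nat, (eps h %% q)%Z = r%:Z%R.
  by exists `|(eps h %% q)%Z|%N; rewrite gez0_abs// modz_ge0// lt0r_neq0.
exists r => /=; first by rewrite -ltz_nat -rE ltz_pmod.
rewrite /rep; case: xgetP => [h' _ [Hh' h'E]|/(_ h)]; last by case.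
have key x y : H x -> H y -> (eps x %% q)%Z = (eps y %% q)%Z ->
    lcoset x L `<=` lcoset y L.
  move=> Hx Hy xy _ [l [Hl ql] <-]; exists (y^-1 * (x * l)); last by rewrite mulVKg.
  split; first by do !apply: subgroupM => //; exact: subgroupV.
  rewrite epsM epsV epsM addrA rpredD// addrC -eqz_mod_dvd.
  exact/eqP.
by rewrite eqEsubset; split; apply: key; rewrite ?h'E ?rE.
Qed.

End NilpotentChain.
(** * The join of the line and the forest *)

Section Model.
Local Open Scope group_scope.
Variables (R : realType) (G : groupType) (eps : G -> int).
Hypothesis epsM : forall x y, eps (x * y) = (eps x + eps y)%R.
Hypothesis A_comm : forall x y, eps x = 0%R -> eps y = 0%R -> commute x y.
Implicit Types (g h s : G) (i j m n : nat) (p q : nat * set G) (H : set G).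
Local Notation K := (chain eps).

(** The index is stored with the coset, which need not determine it: the levels [0!] and [1!] are
    equal. *)
Definition coset_vertex p :=
  exists2 s, eps s = (p.1)`!%:Z%R & p.2 = lcoset s (K p.1).

(* Sends [s K_i] to [s ^+ i.+1 K_i.+1]. *)
Definition up p : nat * set G :=
  (p.1.+1, lcoset (xget 1 p.2 ^+ p.1.+1) (K p.1.+1)).

Lemma lcoset_chain i s s' : lcoset s (K i) = lcoset s' (K i) <-> K i (s^-1 * s').
Proof.
split=> [e|Kss'].
  have : lcoset s' (K i) s' by exists 1; [exact: (chain1 epsM)|rewrite mulg1].
  by rewrite -e => -[x Kx <-]; rewrite mulKg.
rewrite eqEsubset; split=> _ [x Kx <-].
  exists ((s^-1 * s')^-1 * x); last by rewrite invgM invgK -mulgA mulVKg.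
  by apply: (chainM epsM) => //; exact: (chainV epsM).
exists (s^-1 * s' * x); last by rewrite !mulgA mulgV mul1g.
exact: (chainM epsM).
Qed.

Lemma chainX i s s' n : K i (s^-1 * s') -> K i ((s ^+ n)^-1 * s' ^+ n).
Proof.
move=> Kss'; elim: n => [|n IH]; first by rewrite !expg0 mulVg; exact: (chain1 epsM).
have -> : (s ^+ n.+1)^-1 * s' ^+ n.+1 =
    (s^-1 * s') ^ (s ^+ n) * ((s ^+ n)^-1 * s' ^+ n).
  by rewrite !expgS conjgE invgM !mulgA mulgK.
by apply: (chainM epsM) => //; exact: (chainJ epsM).
Qed.

(** Independence of the representative picked by [xget]: powers of elements congruent modulo the
    normal subgroup [K_i] are congruent, and [K_i] lies in [K_(i+1)]. *)
Lemma up_coset i s :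
  up (i, lcoset s (K i)) = (i.+1, lcoset (s ^+ i.+1) (K i.+1)).
Proof.
rewrite /up /=; congr pair; apply/lcoset_chain; apply: (chain_le epsM (leqnSn i)).
apply: chainX; apply/lcoset_chain.
case: xgetP => [s' _ [x Kx <-]|/(_ s)[]]; last first.
  by exists 1; [exact: (chain1 epsM)|rewrite mulg1].
apply/lcoset_chain; rewrite invgM mulgVK; exact: (chainV epsM).
Qed.

Lemma coset_vertex_up p : coset_vertex p -> coset_vertex (up p).
Proof.
case: p => i C [s /= es ->]; rewrite up_coset; exists (s ^+ i.+1) => //=.
by rewrite (epsX epsM) es factS PoszM.
Qed.

Lemma iter_up i s n : iter n up (i, lcoset s (K i)) =
  ((i + n)%N, lcoset (s ^+ ((i + n)`! %/ i`!)) (K (i + n))).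
Proof.
have dv k : (i`! %| (i + k)`!)%N.
  by rewrite -(bin_fact (leq_addr k i)) mulnCA dvdn_mulr.
elim: n => [|n IH]; first by rewrite addn0 divnn fact_gt0 expg1.
by rewrite /= IH up_coset -expgnA addnS factS [(_ %/ _ * _)%N]mulnC muln_divA.
Qed.

(** The inverse turns [^], a right action, into a left action. *)
Definition conj_vertex g p : nat * set G := (p.1, conj_set p.2 g^-1).

Lemma conj_coset i s g : conj_set (lcoset s (K i)) g = lcoset (s ^ g) (K i).
Proof.
rewrite eqEsubset; split=> [_ [_ [x Kx <-] <-]|_ [x Kx <-]].
  by exists (x ^ g); [exact: (chainJ epsM)|rewrite conjMg].
exists (s * x ^ g^-1); last by rewrite conjMg conjgKV.
by exists (x ^ g^-1) => //; exact: (chainJ epsM).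
Qed.

Lemma conj_vertex_coset i s g :
  conj_vertex g (i, lcoset s (K i)) = (i, lcoset (s ^ g^-1) (K i)).
Proof. by rewrite /conj_vertex conj_coset. Qed.

Lemma coset_vertex_conj g p : coset_vertex p -> coset_vertex (conj_vertex g p).
Proof.
case: p => i C [s /= es ->]; rewrite conj_vertex_coset.
by exists (s ^ g^-1) => //=; rewrite (epsJ epsM).
Qed.

Lemma up_conj g p : coset_vertex p -> up (conj_vertex g p) = conj_vertex g (up p).
Proof.
by case: p => i C [s /= es ->]; rewrite !(conj_vertex_coset, up_coset) conjXg.
Qed.

Lemma conj_vertex_fix i s g :
  conj_vertex g (i, lcoset s (K i)) = (i, lcoset s (K i)) <-> K i [~ s, g].
Proof.
rewrite conj_vertex_coset; split=> [[/esym/lcoset_chain]|].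
  by rewrite -commgEl => /(chain_commV epsM).
move=> Kg; congr pair; apply/esym/lcoset_chain; rewrite -commgEl.
exact/(chain_commV epsM).
Qed.

Local Notation W := (int + nat * set G)%type.
Implicit Types (v w : W).

(** The graph whose flag complex is the join: every integer is adjacent to every coset vertex. Pairs
    that are not coset vertices are not adjacent even to themselves, hence are no vertices of the
    complex. *)
Definition adj v w : Prop := match v, w with
  | inl k, inl l => (`|k - l| <= 1)%R
  | inl _, inr p | inr p, inl _ => coset_vertex p
  | inr p, inr q =>
    [/\ coset_vertex p, coset_vertex q & [\/ p = q, q = up p | p = up q]]
  end.

Lemma adj_sym v w : adj v w -> adj w v.
Proof.
case: v w => [k|p] [l|q] //=; first by rewrite distrC.
by case=> vp vq [e|e|e]; split=> //; [exact/Or31/esym|exact: Or33|exact: Or32].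
Qed.

Definition vertex_act g w : W := match w with
  | inl k => inl (k + eps g)%R
  | inr p => inr (conj_vertex g p)
  end.

Lemma vertex_act1 w : vertex_act 1 w = w.
Proof.
case: w => [k|[i C]] /=; first by rewrite (eps1 epsM) addr0.
rewrite /conj_vertex /= invg1; congr (inr (_, _)).
rewrite eqEsubset; split=> [_ [x Cx <-]|x Cx]; first by rewrite conjg1.
by exists x; rewrite ?conjg1.
Qed.

Lemma vertex_actM g h w : vertex_act (g * h) w = vertex_act g (vertex_act h w).
Proof.
case: w => [k|[i C]] /=; first by rewrite epsM; congr inl; lia.
rewrite /conj_vertex /=; congr (inr (_, _)).
rewrite eqEsubset; split=> [_ [x Cx <-]|_ [_ [x Cx <-] <-]].
  by exists (x ^ h^-1); [exists x|rewrite -conjgM invgM].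
by exists x; rewrite // -conjgM invgM.
Qed.

Lemma adj_vertex_act g v w : adj v w -> adj (vertex_act g v) (vertex_act g w).
Proof.
case: v w => [k|p] [l|q] //=; try exact: coset_vertex_conj.
  by rewrite opprD addrACA subrr addr0.
move=> [vp vq pq]; split; try exact: coset_vertex_conj.
case: pq => [->|->|->]; first exact: Or31.
  by apply: Or32; rewrite up_conj.
by apply: Or33; rewrite up_conj.
Qed.

(** On the line, a translation by 1 keeps [w] adjacent to its image but not to its second image. On
    the forest, conjugation preserves the index while a proper edge changes it by 1. *)
Lemma vertex_act_adm g w : adj w (vertex_act g w) ->
  adj w (vertex_act g (vertex_act g w)) -> vertex_act g w = w.
Proof.
case: w => [k|p] /=; first by move=> _ h; congr inl; move: h; lia.
case=> _ _ [<-//|/(congr1 fst)/= e|/(congr1 fst)/= e]; lia.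
Qed.

(** Parity on the line and parity of the index on the forest give a proper colouring with 4 colours,
    which bounds the size of simplices. *)
Definition color w : nat :=
  match w with inl k => odd `|k|%N | inr p => (2 + odd p.1)%N end.

Lemma color_inj v w : adj v w -> color v = color w -> v = w.
Proof.
case: v w => [k|p] [l|q] /=; [|by case: odd; case: odd..|].
  move=> kl /= odd_kl; congr inl; move: kl odd_kl.
  have := odd_double_half `|k|; have := odd_double_half `|l|.
  by case: odd; case: odd => //=; lia.
by case=> _ _ [->//|->|->] /=; case: odd.
Qed.

Lemma card_simplex_le4 (s : {fset W}) : simplex adj s -> (#|` s| <= 4)%N.
Proof.
move=> [_ ss]; have u : uniq (map color s).
  rewrite map_inj_in_uniq ?fset_uniq// => v w vs ws; exact/color_inj/ss.
rewrite -(size_map color) -(size_iota 0 4); apply: uniq_leq_size => //.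
move=> _ /mapP[w _ ->]; rewrite mem_iota.
by case: w => [k|p] /=; case: odd.
Qed.

Definition stable_vertex H p :=
  coset_vertex p /\ forall h, H h -> conj_vertex h p = p.

Definition stable H w := adj w w /\ forall h, H h -> vertex_act h w = w.

Lemma stable_inr H p : stable H (inr p) <-> stable_vertex H p.
Proof.
split=> [[[vp _ _] Hp]|[vp Hp]]; first by split=> // h /Hp [].
by split=> [|h /Hp /= ->//]; split=> //; exact: Or31.
Qed.

Lemma fixed_full_subcomplex H :
  [set x : flag_point R adj | forall w, x w != 0%R ->
    forall h, H h -> vertex_act h w = w] = full_subcomplex (stable H).
Proof.
rewrite eqEsubset; split=> x xH w xw; last by case: (xH w xw).
by split; [apply: (simplex_supp x).2; rewrite mem_supp|exact: xH].
Qed.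

Definition clip n (k : int) : int :=
  if (n%:Z < k)%R then n%:Z%R else if (k < - n%:Z)%R then (- n%:Z)%R else k.

(* Contracts the line first, leaving a cone with apex 0. *)
Definition squash n w : W :=
  match n, w with
  | 0, _ => inl 0%R
  | n.+1, inl k => inl (clip n k)
  | n.+1, inr p => inr p
  end.

(** [H] fixes the whole line, so 0 is available as apex. Clipping adjacent integers at equal or
    consecutive radii leaves them at distance at most 1. *)
Lemma contractible_stable_kernel H : (forall h, H h -> eps h = 0%R) ->
  contractible R (full_subcomplex (R := R) (adj := adj) (stable H)).
Proof.
move=> H0.
have stable_inl k : stable H (inl k).
  by split=> [|h /H0 /= ->]; rewrite /= ?subrr ?addr0.
apply: (@contractible_full_subcomplex R W adj (stable H) squash (inl 0%R)) => //.
- exact: adj_sym.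
- by case=> [|n] [k|p] Sv; rewrite /squash.
- case=> [k|p]; last by exists 1%N; case.
  exists (`|k|.+1)%N => -[//|n] _ kn; rewrite /squash /clip; congr inl.
  by case: ifP; [|case: ifP]; lia.
- move=> [|n] v w Sv Sw vw.
    split=> //; case: w Sw {vw} => [l|q] Sw /=; last by have [[vq _ _] _] := Sw.
    by rewrite /clip; case: ifP; [|case: ifP]; lia.
  case: v w {Sv Sw} vw => [k|p] [l|q] //= vw.
  by rewrite /clip; split; do ![case: ifP => ?]; lia.
Qed.

(** * The fixed tree of a subgroup not contained in [A] *)

Section StableTree.
Variables (H : set G) (h0 : G) (j : nat).
Hypotheses (sH : subgroup H) (Hh0 : H h0) (h0_gt0 : (0 < eps h0)%R).
Hypothesis HK : forall b, H b -> eps b = 0%R -> K j b.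
Local Notation m := `|eps h0|%N.

Let m_gt0 : (0 < m)%N. Proof. by lia. Qed.
Let eps_h0 : eps h0 = m%:Z%R. Proof. by lia. Qed.

(** At least [m], so that [m] divides the factorial and a power of [h0] has the required level; at
    least [j], so that commutators in [H] lie in the chain subgroup. *)
Definition base_level := maxn j m.
Definition base_vertex := (base_level,
  lcoset (h0 ^+ (base_level`! %/ m)) (K base_level)).

Lemma stable_base : stable_vertex H base_vertex.
Proof.
have dm : (m %| base_level`!)%N by apply: dvdn_fact; rewrite m_gt0 leq_maxr.
split; first by exists (h0 ^+ (base_level`! %/ m)); rewrite //= (epsX epsM) eps_h0 -PoszM divnK.
have HX n : H (h0 ^+ n).
  elim: n => [|n IH]; first by case: ((subgroupP H).1 sH).
  by rewrite expgS; exact: subgroupM.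
move=> h Hh; apply/conj_vertex_fix; apply: (chain_le epsM (leq_maxl j m)).
apply: HK; last exact: (epsR epsM).
rewrite commgEl conjgE; apply: subgroupM => //; first exact: subgroupV.
by apply: subgroupM => //; [exact: subgroupV|exact: subgroupM].
Qed.

Lemma stable_up p : stable_vertex H p -> stable_vertex H (up p).
Proof.
by move=> [vp Hp]; split=> [|h /Hp e]; [exact: coset_vertex_up|rewrite -up_conj ?e].
Qed.

Lemma stable_iter_up p n : stable_vertex H p -> stable_vertex H (iter n up p).
Proof. by move=> Hp; elim: n => //= n; exact: stable_up. Qed.

Lemma iter_up_level p n : (iter n up p).1 = (p.1 + n)%N.
Proof. by elim: n => [|n IH]; rewrite ?addn0//= IH addnS. Qed.

Definition ray n := iter n up base_vertex.

(** Edges of the forest point upwards, towards an end. To root the tree at [base_vertex], the edges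
    along its ascending ray are reversed; the root is its own parent since [0.-1] is 0. *)
Definition parent p : nat * set G :=
  let n := (p.1 - base_level)%N in if p == ray n then ray n.-1 else up p.

Lemma parent_ray n : parent (ray n) = ray n.-1.
Proof. by rewrite /parent iter_up_level addKn eqxx. Qed.

Lemma iter_parent_ray n : iter n parent (ray n) = base_vertex.
Proof. by elim: n => [//|n IH]; rewrite iterSr parent_ray. Qed.

Lemma parentP p : (exists n, p = ray n) \/ parent p = up p.
Proof. by rewrite /parent; case: eqP => [e|_]; [left; eexists; exact: e|right]. Qed.

(** The level 0 element [u x] commutes with [h0] modulo [K_i], so [chain_up] places it in a later
    subgroup, modulo which [s ^+ m] and [s' ^+ m] agree. *)
Lemma merge_level i s s' : eps s = i`!%:Z%R -> eps s' = i`!%:Z%R ->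
    K i [~ s, h0] -> K i [~ s', h0] ->
  exists n, iter n up (i, lcoset s (K i)) = iter n up (i, lcoset s' (K i)).
Proof.
move=> es es' Ks Ks'; pose u x := x ^+ m * (h0 ^+ i`!)^-1.
have Ku x : eps x = i`!%:Z%R -> K i [~ x, h0] -> K (maxn i m).+1 (u x).
  move=> ex Kx; apply: (chain_up epsM A_comm (leq_maxl i m) _ _ (g := h0)).
  - by rewrite epsM (epsV epsM) !(epsX epsM) ex eps_h0; lia.
  - by rewrite h0_gt0 eps_h0 lez_nat leqW// leq_maxr.
  rewrite commMg; apply: (chainM epsM).
    apply: (chainJ epsM); apply: (chain_commC epsM); apply: (chain_commX epsM).
    exact: (chain_commC epsM).
  have -> : [~ (h0 ^+ i`!)^-1, h0] = 1; last exact: (chain1 epsM).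
  by apply/eqP/commgP/commute_sym/commuteV/commuteX/commute_refl.
have Kss' : K (maxn i m).+1 ((s ^+ m)^-1 * s' ^+ m).
  have uE x : x ^+ m = u x * h0 ^+ i`! by rewrite mulgVK.
  have -> : (s ^+ m)^-1 * s' ^+ m = ((u s)^-1 * u s') ^ (h0 ^+ i`!).
    by rewrite !uE conjgE invgM !mulgA.
  by apply/(chainJ epsM)/(chainM epsM); [apply: (chainV epsM)|]; exact: Ku.
(* After [n] steps the exponent is [n!] times a binomial coefficient. It is a multiple of [m], as
   [m] is at most [n]. *)
exists (maxn i m).+1; set n := (maxn i m).+1; rewrite !iter_up.
have /dvdnP[c cE] : (m %| n`!)%N.
  by apply: dvdn_fact; rewrite m_gt0 /n leqW// leq_maxr.
have -> : ((i + n)`! %/ i`! = m * (c * 'C(i + n, i)))%N.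
  rewrite -(bin_fact (leq_addr n i)) addKn cE mulnCA mulKn ?fact_gt0//.
  by rewrite mulnC [(c * m)%N]mulnC mulnA.
congr pair; apply/lcoset_chain; rewrite !(expgnA _ m); apply: chainX.
exact: (chain_le epsM (leq_addl i n) Kss').
Qed.

(** Both [p] and the base vertex are first raised to the common index [i], where [merge_level]
    applies. *)
Lemma merge p : stable_vertex H p -> exists n k, iter n up p = ray k.
Proof.
move=> Hp; pose i := maxn p.1 base_level.
have rep q : stable_vertex H q -> q.1 = i -> exists s,
    [/\ eps s = i`!%:Z%R, q = (i, lcoset s (K i)) & K i [~ s, h0]].
  case: q => i' C [[s /= es ->] Hq] <-; exists s; split=> //.
  by apply/conj_vertex_fix; exact: Hq.
have [s [es pE Ks]] := rep _ (stable_iter_up (i - p.1) Hp)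
  (etrans (iter_up_level _ _) (subnKC (leq_maxl _ _))).
have [s' [es' bE Ks']] := rep _ (stable_iter_up (i - base_level) stable_base)
  (etrans (iter_up_level _ _) (subnKC (leq_maxr _ _))).
have [n nE] := merge_level es es' Ks Ks'.
exists (n + (i - p.1))%N, (n + (i - base_level))%N.
by rewrite /ray !iterD pE bE.
Qed.

(** Induction on the number of upward steps to the ray: off the ray the parent is [up p], and on the
    ray one descends to the root. *)
Lemma parent_reach p : stable_vertex H p -> exists n, iter n parent p = base_vertex.
Proof.
move=> /merge[n]; elim: n p => [|n IH] p [k pk].
  by move: pk => /= ->; exists k; exact: iter_parent_ray.
have [[l ->]|pE] := parentP p; first by exists l; exact: iter_parent_ray.
have [|r rE] := IH (up p); first by exists k; rewrite -iterSr.
by exists r.+1; rewrite iterSr pE.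
Qed.

Lemma stable_parent p : stable_vertex H p -> stable_vertex H (parent p).
Proof.
move=> Hp; have [[n ->]|->] := parentP p; last exact: stable_up.
by rewrite parent_ray; apply: stable_iter_up; exact: stable_base.
Qed.

Lemma adj_parent p : stable_vertex H p -> adj (inr p) (inr (parent p)).
Proof.
move=> Hp; have [vp _] := Hp; have [vpp _] := stable_parent Hp; split=> //.
have [[[|n] ->]|->] := parentP p; last exact: Or32.
  by rewrite parent_ray; exact: Or31.
by rewrite parent_ray; exact: Or33.
Qed.

Lemma up_parent p q : q = up p -> q = parent p \/ p = parent q.
Proof.
move=> ->; have [[n ->]|->] := parentP p; last by left.
by right; rewrite -[up _]/(ray n.+1) parent_ray.
Qed.

Lemma contractible_stable_tree :
  contractible R (full_subcomplex (R := R) (adj := adj) (stable H)).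
Proof.
have no_inl k : ~ stable H (inl k) by move=> [_ /(_ _ Hh0)] /= []; lia.
pose P w : W := if w is inr p then inr (parent p) else w.
apply: (@contractible_rooted_tree R W adj (stable H) P (inr base_vertex)).
- exact: adj_sym.
- by move=> v [].
- exact/stable_inr/stable_base.
- by rewrite /P -[base_vertex]/(ray 0) parent_ray.
- by case=> [k /no_inl//|p /stable_inr Hp]; exact/stable_inr/stable_parent.
- by case=> [k /no_inl//|p /stable_inr]; exact: adj_parent.
- case=> [k /no_inl//|p /stable_inr /parent_reach[n nE]]; exists n.
  by rewrite -nE; elim: n {nE} => //= n ->.
- case=> [k ? /no_inl//|p] [l _ /no_inl//|q] _ _ [_ _ []].
  + by move=> ->; exact: Or31.
  + by move=> /up_parent[->|->]; [exact: Or32|exact: Or33].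
  + by move=> /up_parent[->|->]; [exact: Or33|exact: Or32].
Qed.

End StableTree.

Variable t : G.
Hypothesis eps_t : eps t = 1%R.

(** An edge of the line joined with the forest edge going up from the coset of [t]. *)
Lemma simplex4 : exists2 s : {fset W}, simplex adj s & #|` s| = 4.
Proof.
pose p := (0, lcoset t (K 0)).
have vp : coset_vertex p by exists t.
have vp' := coset_vertex_up vp.
exists (inl 0%R |` (inl 1%R |` (inr p |` [fset inr (up p)])))%fset.
  split; first by apply/fset0Pn; exists (inl 0%R); rewrite !inE eqxx.
  move=> v w; rewrite !inE => /or4P[] /eqP -> /or4P[] /eqP -> //=;
    split=> //; by [exact: Or31|exact: Or32|exact: Or33].
have /negPf pn : (inr p : W) != inr (up p) 
  by apply/eqP => /(congr1 (fun w : W => if w is inr q then q.1 else 0%N)).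
by rewrite !cardfsU1 cardfs1 !inE pn.
Qed.

(** One fixed vertex suffices. A fixed integer forces [H] to have level 0; a fixed coset of [s]
    makes level 0 elements of [H] commute with [s] modulo [K_i], and [s] has level [i!], whence the
    bound [maxn i i!]. *)
Lemma stable_virtually_nilpotent H (x : flag_point R adj) :
  subgroup H -> full_subcomplex (stable H) x -> virtually_nilpotent H.
Proof.
move=> sH xH; have /fset0Pn[w] := supp_neq0 x; rewrite mem_supp => /xH.
case: w => [k [_ Hk]|[i C] /stable_inr[[s /= es ->] Hs]].
  apply: (abelian_virtually_nilpotent A_comm) => // h /Hk /= []; lia.
apply: (chain_virtually_nilpotent epsM A_comm eps_t (i := (maxn i i`!).+1)) => // b Hb b0.
apply: (chain_up epsM A_comm (leq_maxl i i`!) b0 (g := s)).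
  by rewrite es ltz_nat fact_gt0 lez_nat leqW// leq_maxr.
by apply/(chain_commC epsM)/conj_vertex_fix/Hs.
Qed.

Lemma flag_model : exists X : gcw_complex R G,
  has_dimension (gcw_cw X) 3 /\ is_model (virtually_nilpotent_family G) X.
Proof.
exists (flag_gcw R vertex_act1 vertex_actM adj_vertex_act vertex_act_adm); split.
  apply: flag_has_dimension; [exact: card_simplex_le4|exact: simplex4].
move=> H sH; rewrite flag_fixed_points fixed_full_subcomplex /=; split=> [[_ vH]|nH].
  have [H0|] := pselect (forall h, H h -> eps h = 0%R).
    exact: contractible_stable_kernel.
  move=> /existsNP[g /not_implyP[Hg g0]].
  have [i HK] := virtually_nilpotent_chain epsM A_comm sH vH Hg g0.
  (* The tree is built from an element of positive level; [g] or its inverse is one. *)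
  have [gt0|le0] := ltP 0%R (eps g).
    exact: (contractible_stable_tree sH Hg gt0 HK).
  apply: (contractible_stable_tree sH (subgroupV sH Hg) _ HK).
  by rewrite (epsV epsM); lia.
rewrite -subset0 => x xH; apply: nH; split=> //.
exact: stable_virtually_nilpotent xH.
Qed.

End Model.

Theorem theoremB (R : realType) (G : groupType) (A T : set G)
    (GAT : semidirect_product A T)
    (T_cyclic : infinite_cyclic T)
    (A_abelian : abelian_set A)
    (A_countable : countable A) :
  exists X : gcw_complex R G,
    has_dimension (gcw_cw X) 3 /\ is_model (virtually_nilpotent_family G) X.
Proof.
have [eps [epsM epsA [t eps_t]]] := level_map_exists GAT T_cyclic.
apply: (flag_model R epsM _ eps_t) => x y x0 y0.
by apply: A_abelian; exact/epsA.
Qed.
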